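(* Let $\mathsf{k}$ be a field, $n\ge 1$, and let $\mathbf a=(a_1,\dots,a_n)$, $\mathbf b=(b_1,\dots,b_n)$ be vectors of positive integers that are fan ordered. Let $Q=Q(\mathbf a,\mathbf b)=\{(r,s,t_1,\dots,t_n)\in\mathbb N^{n+2} : t_i\ge \max(a_ir,b_is),\ i=1,\dots,n\}$ and let $\mathcal B(\mathbf a,\mathbf b)$ be the associated intersection algebra. Then $$\operatorname{Cl}(\mathcal B(\mathbf a,\mathbf b))=\operatorname{Cl}(Q)\cong\mathbb Z^n .$$
   Context: $\mathbb N=\mathbb Z_{\ge 0}$. Let $R=\mathsf{k}[x_1,\dots,x_n]$, $I=(x_1^{a_1}\cdots x_n^{a_n})$, $J=(x_1^{b_1}\cdots x_n^{b_n})$. The intersection algebra is $\mathcal B(\mathbf a,\mathbf b)=\bigoplus_{r,s\in\mathbb N}(I^r\cap J^s)$, realized as the subring $\sum_{r,s\in\mathbb N}(I^r\cap J^s)u^rv^s$ of $R[u,v]$, with $u,v$ indeterminates. It equals the semigroup ring $\mathsf{k}[Q]$, where $(r,s,t_1,\dots,t_n)\in Q$ corresponds to the monomial $u^rv^sx_1^{t_1}\cdots x_n^{t_n}$. The vectors are fan ordered if $a_i/b_i\ge a_{i+1}/b_{i+1}$ for $i=1,\dots,n-1$. $\operatorname{Cl}(\mathcal B)$ is the divisor class group of the normal Noetherian domain $\mathcal B$. $\operatorname{Cl}(Q)$ is the divisor class group of the normal affine monoid $Q$: the group of divisorial fractional monoid ideals of $Q$ (subsets of the group $\operatorname{gp}(Q)$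 generated by $Q$) modulo the principal ones $m+Q$, $m\in\operatorname{gp}(Q)$. The equality $\operatorname{Cl}(\mathcal B)=\operatorname{Cl}(Q)$ is meant as the natural isomorphism. *)

(* Defs.v *)
From HB Require Import structures.
From mathcomp Require Import all_boot all_order all_algebra.
From mathcomp Require Import generic_quotient fraction.
From mathcomp Require Import mpoly.
From mathcomp Require Import mathcomp_extra boolp classical_sets.

Set Implicit Arguments.
Unset Strict Implicit.
Unset Printing Implicit Defensive.

Import Order.TTheory GRing.Theory Num.Theory.
Local Open Scope ring_scope.
Local Open Scope classical_set_scope.
Local Open Scope quotient_scope.

(* The divisor class group is built below for an arbitrary submonoid [Q] of an
   abelian group, and for an arbitrary subring [A] of a field, as the quotient
   of the divisorial fractional ideals, multiplied by
   [(I, J) |-> (A : (A : I J))], by the principal ones.  Without any normality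
   assumption this is a commutative monoid, written additively (hence only an
   [nmodType]); it is a group when [Q], resp. [A], is completely integrally
   closed, in particular for a normal affine monoid, resp. a normal Noetherian
   domain. *)

Section MonoidClassGroup.
Variables (L : zmodType) (Q : addrClosed L).
Implicit Types I J H : set L.

Definition gp : set L :=
  [set z | exists x y, [/\ x \in Q, y \in Q & z = x - y]].

Definition mfractional I : Prop :=
  [/\ I `<=` gp, I !=set0, (forall q x, q \in Q -> I x -> I (q + x))
    & exists2 d, d \in Q & forall x, I x -> d + x \in Q].

Definition mcolon I : set L := [set z | gp z /\ forall x, I x -> z + x \in Q].

Definition mdivisorial I : Prop := mfractional I /\ mcolon (mcolon I) = I.

Definition msum I J : set L :=
  [set z | exists x y, [/\ I x, J y & z = x + y]].

Definition mtranslate (m : L) I : set L := [set m + x | x in I].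

Lemma gpD x y : gp x -> gp y -> gp (x + y).
Proof.
move=> [x1 [x2 [? ? ->]]] [y1 [y2 [? ? ->]]].
by exists (x1 + y1), (x2 + y2); rewrite !rpredD // opprD addrACA.
Qed.

Lemma gpN x : gp x -> gp (- x).
Proof. by move=> [x1 [x2 [? ? ->]]]; exists x2, x1; rewrite opprB. Qed.

Lemma gpQ x : x \in Q -> gp x.
Proof. by move=> Qx; exists x, 0; rewrite rpred0 subr0. Qed.

Lemma mcolonS I J : I `<=` J -> mcolon J `<=` mcolon I.
Proof. by move=> IJ z [gz Jz]; split=> // x /IJ /Jz. Qed.

Lemma sub_mcolon2 I : I `<=` gp -> I `<=` mcolon (mcolon I).
Proof.
by move=> Ig x Ix; split; [exact: Ig|move=> z [_ /(_ x Ix)]; rewrite addrC].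
Qed.

Lemma mcolon_gp I : mcolon I `<=` gp. Proof. by move=> z []. Qed.

Lemma mcolon3 I : I `<=` gp -> mcolon (mcolon (mcolon I)) = mcolon I.
Proof.
move=> Ig; apply/seteqP; split; first by apply: mcolonS; exact: sub_mcolon2.
by apply: sub_mcolon2; exact: mcolon_gp.
Qed.

Lemma msumC I J : msum I J = msum J I.
Proof.
by apply/seteqP; split=> z [x [y [? ? ->]]]; exists y, x; rewrite addrC.
Qed.

Lemma msumA I J H : msum I (msum J H) = msum (msum I J) H.
Proof.
apply/seteqP; split=> z.
- move=> [x [_ [Ix [y [w [Jy Hw ->]]] ->]]]; rewrite addrA.
  by exists (x + y), w; split=> //; exists x, y.
- move=> [_ [w [[x [y [Ix Jy ->]]] Hw ->]]]; rewrite -addrA.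
  by exists x, (y + w); split=> //; exists y, w.
Qed.

Lemma msum_gp I J : I `<=` gp -> J `<=` gp -> msum I J `<=` gp.
Proof. by move=> Ig Jg z [x [y [/Ig gx /Jg gy ->]]]; exact: gpD. Qed.

Lemma mcolon_msum I J : I `<=` gp -> J `<=` gp ->
  mcolon (msum (mcolon (mcolon I)) J) = mcolon (msum I J).
Proof.
move=> Ig Jg; apply/seteqP; split.
  apply: mcolonS => z [x [y [Ix Jy ->]]].
  by exists x, y; split=> //; exact: sub_mcolon2.
move=> z [gz IJz]; split=> // _ [x [y [[_ Ix] Jy ->]]].
rewrite addrCA; apply: Ix.
split; first by apply: gpD => //; exact: Jg.
by move=> w Iw; rewrite -addrA [y + w]addrC; apply: IJz; exists w, y.
Qed.

Lemma mdivisorial_colon2 I :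
  I `<=` gp -> I !=set0 -> (exists2 d, d \in Q & forall x, I x -> d + x \in Q) ->
  mdivisorial (mcolon (mcolon I)).
Proof.
move=> Ig [x0 Ix0] [d Qd dI]; split; last first.
  by rewrite mcolon3 //; exact: mcolon_gp.
split; first exact: mcolon_gp.
- by exists x0; exact: sub_mcolon2.
- move=> q x Qq [gx Ix]; split; first by apply: gpD => //; exact: gpQ.
  by move=> z /Ix zx; rewrite -addrA rpredD.
- exists d => // x [_]; rewrite addrC; apply.
  by split=> //; exact: gpQ.
Qed.

Record mdiv : Type := MDiv {
  mdiv_set :> set L;
  mdivP : mdivisorial mdiv_set }.

HB.instance Definition _ := gen_eqMixin mdiv.
HB.instance Definition _ := gen_choiceMixin mdiv.

Lemma mdiv_inj (D E : mdiv) : mdiv_set D = mdiv_set E -> D = E.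
Proof.
by case: D E => [D DP] [E EP] /= DE; case: _ / DE in EP *; congr MDiv.
Qed.

Lemma mdiv_gp (D : mdiv) : mdiv_set D `<=` gp.
Proof. by case: D => D [[]]. Qed.

Lemma mdivK (D : mdiv) : mcolon (mcolon D) = D.
Proof. by case: D => D []. Qed.

Lemma mdiv_mul_subproof (D E : mdiv) :
  mdivisorial (mcolon (mcolon (msum D E))).
Proof.
case: D E => [D [[Dg [x Dx] _ [d Qd dD]] _]] [E [[Eg [y Ey] _ [e Qe eE]] _]] /=.
apply: mdivisorial_colon2; first exact: msum_gp.
  by exists (x + y), x, y.
exists (d + e); first exact: rpredD.
by move=> _ [u [v [Du Ev ->]]]; rewrite addrACA rpredD ?dD ?eE.
Qed.

Definition mdiv_mul (D E : mdiv) : mdiv := MDiv (mdiv_mul_subproof D E).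

Lemma mdiv_one_subproof : mdivisorial [set x | x \in Q].
Proof.
have QE : mcolon [set x | x \in Q] = [set x | x \in Q].
  apply/seteqP; split=> z /=.
    by move=> [_ /(_ 0)]; rewrite addr0; apply; rewrite /= rpred0.
  by move=> Qz; split; [exact: gpQ|move=> x Qx; rewrite rpredD].
split; last by rewrite !QE.
split; first by move=> x; exact: gpQ.
- by exists 0; rewrite /= rpred0.
- by move=> q x Qq Qx; rewrite /= rpredD.
- by exists 0; [rewrite rpred0|move=> x; rewrite add0r].
Qed.

Definition mdiv_one : mdiv := MDiv mdiv_one_subproof.

Definition mdiv_equiv (D E : mdiv) : bool :=
  `[< exists2 m, gp m & mdiv_set D = mtranslate m E >].

Lemma mdiv_mulC : commutative mdiv_mul.
Proof. by move=> D E; apply: mdiv_inj; rewrite /= msumC. Qed.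

Lemma mdiv_mulA : associative mdiv_mul.
Proof.
move=> D E F; apply: mdiv_inj => /=; congr mcolon.
have gDE : msum D E `<=` gp by apply: msum_gp; exact: mdiv_gp.
have gEF : msum E F `<=` gp by apply: msum_gp; exact: mdiv_gp.
rewrite msumC !mcolon_msum //; try exact: mdiv_gp.
by rewrite msumC msumA.
Qed.

Lemma mdiv_mul1 : left_id mdiv_one mdiv_mul.
Proof.
move=> D; apply: mdiv_inj => /=.
suff -> : msum [set x | x \in Q] D = D by exact: mdivK.
case: D => D [[Dg D0 QD dD] DK] /=.
apply/seteqP; split=> z; first by move=> [x [y [/= Qx Dy ->]]]; exact: QD.
by move=> Dz; exists 0, z; rewrite /= rpred0 add0r.
Qed.

Lemma mdiv_equiv_refl : reflexive mdiv_equiv.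
Proof.
move=> D; apply/asboolP; exists 0; first by apply: gpQ; exact: rpred0.
apply/seteqP; split=> [x Dx|_ [x Dx <-]]; last by rewrite add0r.
by exists x => //; rewrite add0r.
Qed.

Lemma mdiv_equiv_sub (D E : mdiv) : mdiv_equiv D E -> mdiv_equiv E D.
Proof.
move=> /asboolP [m gm DE]; apply/asboolP; exists (- m); first exact: gpN.
rewrite DE; apply/seteqP; split=> [x Ex|_ [_ [x Ex <-] <-]].
  by exists (m + x); [exists x|rewrite addKr].
by rewrite addKr.
Qed.

Lemma mdiv_equiv_sym : ssrbool.symmetric mdiv_equiv.
Proof. by move=> D E; apply/idP/idP; exact: mdiv_equiv_sub. Qed.

Lemma mdiv_equiv_trans : transitive mdiv_equiv.
Proof.
move=> E D F /asboolP [m gm DE] /asboolP [p gp_p EF]; apply/asboolP.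
exists (m + p); first exact: gpD.
rewrite DE EF; apply/seteqP; split=> [_ [_ [x Fx <-] <-]|_ [x Fx <-]].
  by exists x => //; rewrite addrA.
by exists (p + x); [exists x|rewrite addrA].
Qed.

Canonical mdiv_equiv_rel :=
  EquivRel mdiv_equiv mdiv_equiv_refl mdiv_equiv_sym mdiv_equiv_trans.

Lemma mcolon_translate m I : gp m ->
  mcolon (mtranslate m I) = mtranslate (- m) (mcolon I).
Proof.
move=> gm; apply/seteqP; split=> [z [gz mI]|_ [z [gz Iz] <-]].
  exists (m + z); last by rewrite addKr.
  split; first exact: gpD.
  by move=> x Ix; rewrite -addrA addrCA; apply: mI; exists x.
split; first by apply: gpD => //; exact: gpN.
move=> _ [x Ix <-].
by rewrite [- m + z]addrC -addrA addKr; exact: Iz.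
Qed.

Lemma mdiv_equiv_mul D D' E :
  mdiv_equiv D D' -> mdiv_equiv (mdiv_mul D E) (mdiv_mul D' E).
Proof.
move=> /asboolP [m gm DE]; apply/asboolP; exists m => //=; rewrite DE.
have -> : msum (mtranslate m D') E = mtranslate m (msum D' E).
  apply/seteqP; split=> [_ [_ [y [[x Dx <-] Ey ->]]]|_ [_ [x [y [Dx Ey ->]]] <-]].
    by rewrite -addrA; exists (x + y) => //; exists x, y.
  by rewrite addrA; exists (m + x), y; split=> //; exists x.
by rewrite !mcolon_translate ?opprK //; exact: gpN.
Qed.

Definition mClass : Type := {eq_quot mdiv_equiv}.
HB.instance Definition _ := Choice.on mClass.
HB.instance Definition _ := EqQuotient.on mClass.

Definition mclass (D : mdiv) : mClass := \pi_mClass D.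

Lemma mclassP (D E : mdiv) :
  mclass D = mclass E <-> exists2 m, gp m & mdiv_set D = mtranslate m E.
Proof.
split=> [/eqquotP /asboolP //|DE]; apply/eqquotP; exact/asboolP.
Qed.

Definition mClass_add (x y : mClass) : mClass :=
  mclass (mdiv_mul (repr x) (repr y)).

Lemma mclassM (D E : mdiv) :
  mClass_add (mclass D) (mclass E) = mclass (mdiv_mul D E).
Proof.
have reprE F : mdiv_equiv (repr (mclass F)) F.
  by apply/(@eqquotP _ _ mClass); rewrite reprK.
apply/eqquotP; apply: (@mdiv_equiv_trans (mdiv_mul D (repr (mclass E)))).
  exact: mdiv_equiv_mul.
by rewrite ![mdiv_mul D _]mdiv_mulC; exact: mdiv_equiv_mul.
Qed.

Lemma mclass_repr (x : mClass) : mclass (repr x) = x.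
Proof. exact: reprK. Qed.

Lemma mClass_addA : associative mClass_add.
Proof.
move=> x y z; rewrite -(mclass_repr x) -(mclass_repr y) -(mclass_repr z).
by rewrite !mclassM mdiv_mulA.
Qed.

Lemma mClass_addC : commutative mClass_add.
Proof.
move=> x y; rewrite -(mclass_repr x) -(mclass_repr y).
by rewrite !mclassM mdiv_mulC.
Qed.

Lemma mClass_add0 : left_id (mclass mdiv_one) mClass_add.
Proof. by move=> x; rewrite -(mclass_repr x) mclassM mdiv_mul1. Qed.

HB.instance Definition _ :=
  GRing.isNmodule.Build mClass mClass_addA mClass_addC mClass_add0.

End MonoidClassGroup.

Definition ideal_mul (S : comNzRingType) (I J : set S) : set S :=
  [set z | exists2 s : seq (S * S),
     (forall p, p \in s -> I p.1 /\ J p.2) & z = \sum_(p <- s) p.1 * p.2].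

Section IdealMul.
Variable S : comNzRingType.
Implicit Types I J H : set S.

Lemma ideal_mulD I J x y :
  ideal_mul I J x -> ideal_mul I J y -> ideal_mul I J (x + y).
Proof.
move=> [s sP ->] [t tP ->]; exists (s ++ t); last by rewrite big_cat.
by move=> p; rewrite mem_cat => /orP[/sP|/tP].
Qed.

Lemma ideal_mul0 I J : ideal_mul I J 0.
Proof. by exists [::] => //; rewrite big_nil. Qed.

Lemma ideal_mulM I J x y : I x -> J y -> ideal_mul I J (x * y).
Proof.
move=> Ix Jy; exists [:: (x, y)]; last by rewrite big_seq1.
by move=> p; rewrite inE => /eqP ->.
Qed.

Lemma ideal_mul_ind I J (P : S -> Prop) :
  P 0 -> (forall x y, P x -> P y -> P (x + y)) ->
  (forall x y, I x -> J y -> P (x * y)) -> forall z, ideal_mul I J z -> P z.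
Proof.
move=> P0 PD PM _ [s sP ->]; rewrite big_seq.
by apply: big_ind => // p /sP [Ip Jp]; exact: PM.
Qed.

Lemma ideal_mulC I J : ideal_mul I J = ideal_mul J I.
Proof.
by apply/seteqP; split; apply: ideal_mul_ind;
  by [exact: ideal_mul0|exact: ideal_mulD|
      move=> x y ? ?; rewrite mulrC; exact: ideal_mulM].
Qed.

Lemma ideal_mulA I J H :
  ideal_mul I (ideal_mul J H) = ideal_mul (ideal_mul I J) H.
Proof.
apply/seteqP; split; apply: ideal_mul_ind;
  do ?[exact: ideal_mul0|exact: ideal_mulD].
- move=> x y Ix; move: y; apply: ideal_mul_ind.
  + by rewrite mulr0; exact: ideal_mul0.
  + by move=> u v; rewrite mulrDr; exact: ideal_mulD.
  + by move=> y z Jy Hz; rewrite mulrA; apply: ideal_mulM => //; exact: ideal_mulM.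
- move=> x y + Hy; move: x; apply: ideal_mul_ind.
  + by rewrite mul0r; exact: ideal_mul0.
  + by move=> u v; rewrite mulrDl; exact: ideal_mulD.
  + by move=> x z Ix Jz; rewrite -mulrA; apply: ideal_mulM => //; exact: ideal_mulM.
Qed.

End IdealMul.

Section RingClassGroup.
Variables (K : fieldType) (A : subringClosed K).
Implicit Types I J H : set K.

Definition Frac : set K :=
  [set z | exists x y, [/\ x \in A, y \in A, y != 0 & z = x / y]].

Definition fractional I : Prop :=
  [/\ I `<=` Frac /\ (exists2 x, I x & x != 0),
      (forall x y, I x -> I y -> I (x + y)),
      (forall c x, c \in A -> I x -> I (c * x))
    & exists2 d, d \in A /\ d != 0 & forall x, I x -> d * x \in A].

Definition colon I : set K := [set z | Frac z /\ forall x, I x -> z * x \in A].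

Definition divisorial I : Prop := fractional I /\ colon (colon I) = I.

Definition scale (c : K) I : set K := [set c * x | x in I].

Lemma Frac_A x : x \in A -> Frac x.
Proof. by move=> Ax; exists x, 1; rewrite rpred1 oner_eq0 divr1. Qed.

Lemma FracM x y : Frac x -> Frac y -> Frac (x * y).
Proof.
move=> [x1 [x2 [? ? x20 ->]]] [y1 [y2 [? ? y20 ->]]].
by exists (x1 * y1), (x2 * y2); rewrite !rpredM ?mulf_neq0 // invfM mulrACA.
Qed.

Lemma FracD x y : Frac x -> Frac y -> Frac (x + y).
Proof.
move=> [x1 [x2 [? ? x20 ->]]] [y1 [y2 [? ? y20 ->]]].
exists (x1 * y2 + y1 * x2), (x2 * y2).
by rewrite rpredD ?rpredM ?mulf_neq0 // addf_div.
Qed.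

Lemma FracV x : Frac x -> Frac x^-1.
Proof.
move=> [x1 [x2 [? ? x20 ->]]]; rewrite invf_div.
have [->|x10] := eqVneq x1 0; last by exists x2, x1.
by rewrite invr0 mulr0; apply: Frac_A; exact: rpred0.
Qed.

Lemma colonS I J : I `<=` J -> colon J `<=` colon I.
Proof. by move=> IJ z [gz Jz]; split=> // x /IJ /Jz. Qed.

Lemma sub_colon2 I : I `<=` Frac -> I `<=` colon (colon I).
Proof.
by move=> Ig x Ix; split; [exact: Ig|move=> z [_ /(_ x Ix)]; rewrite mulrC].
Qed.

Lemma colon_Frac I : colon I `<=` Frac. Proof. by move=> z []. Qed.

Lemma colon3 I : I `<=` Frac -> colon (colon (colon I)) = colon I.
Proof.
move=> Ig; apply/seteqP; split; first by apply: colonS; exact: sub_colon2.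
by apply: sub_colon2; exact: colon_Frac.
Qed.

Lemma ideal_mul_Frac I J :
  I `<=` Frac -> J `<=` Frac -> ideal_mul I J `<=` Frac.
Proof.
move=> Ig Jg; apply: ideal_mul_ind.
- by apply: Frac_A; exact: rpred0.
- exact: FracD.
- by move=> x y /Ig gx /Jg gy; exact: FracM.
Qed.

Lemma colon_mulE I J z : colon (ideal_mul I J) z <->
  Frac z /\ forall x y, I x -> J y -> z * (x * y) \in A.
Proof.
split=> [[gz IJz]|[gz IJz]]; split=> //.
  by move=> x y Ix Jy; apply: IJz; exact: ideal_mulM.
apply: ideal_mul_ind => //; first by rewrite mulr0 rpred0.
by move=> x y zx zy; rewrite mulrDr rpredD.
Qed.

Lemma colon_mul I J : I `<=` Frac -> J `<=` Frac ->
  colon (ideal_mul (colon (colon I)) J) = colon (ideal_mul I J).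
Proof.
move=> Ig Jg; apply/seteqP; split=> z /colon_mulE [gz IJz]; apply/colon_mulE.
  by split=> // x y Ix Jy; apply: IJz => //; exact: sub_colon2.
split=> // x y [_ Ix] Jy; rewrite mulrCA; apply: Ix.
split; first by apply: FracM => //; exact: Jg.
by move=> w Iw; rewrite -mulrA [y * w]mulrC; exact: IJz.
Qed.

Lemma divisorial_colon2 I :
  I `<=` Frac -> (exists2 x, I x & x != 0) ->
  (exists2 d, d \in A /\ d != 0 & forall x, I x -> d * x \in A) ->
  divisorial (colon (colon I)).
Proof.
move=> Ig [x0 Ix0 x00] [d [Ad d0] dI]; split; last first.
  by rewrite colon3 //; exact: colon_Frac.
split.
- by split; [exact: colon_Frac|exists x0 => //; exact: sub_colon2].
- move=> x y [gx Ix] [gy Iy]; split; first exact: FracD.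
  by move=> z Iz; rewrite mulrDl rpredD ?Ix ?Iy.
- move=> q x Aq [gx Ix]; split; first by apply: FracM => //; exact: Frac_A.
  by move=> z /Ix zx; rewrite -mulrA rpredM.
- exists d => // x [_]; rewrite mulrC; apply.
  by split=> //; exact: Frac_A.
Qed.

Record rdiv : Type := RDiv {
  rdiv_set :> set K;
  rdivP : divisorial rdiv_set }.

HB.instance Definition _ := gen_eqMixin rdiv.
HB.instance Definition _ := gen_choiceMixin rdiv.

Lemma rdiv_inj (D E : rdiv) : rdiv_set D = rdiv_set E -> D = E.
Proof.
by case: D E => [D DP] [E EP] /= DE; case: _ / DE in EP *; congr RDiv.
Qed.

Lemma rdiv_Frac (D : rdiv) : rdiv_set D `<=` Frac.
Proof. by case: D => D [[[]]]. Qed.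

Lemma rdivK (D : rdiv) : colon (colon D) = D.
Proof. by case: D => D []. Qed.

Lemma rdiv_mul_subproof (D E : rdiv) :
  divisorial (colon (colon (ideal_mul D E))).
Proof.
have [[[Dg [x Dx x0]] _ _ [d [Ad d0] dD]] _] := rdivP D.
have [[[Eg [y Ey y0]] _ _ [e [Ae e0] eE]] _] := rdivP E.
apply: divisorial_colon2; first exact: ideal_mul_Frac.
  by exists (x * y); [exact: ideal_mulM|rewrite mulf_neq0].
exists (d * e); first by rewrite rpredM // mulf_neq0.
apply: ideal_mul_ind; first by rewrite mulr0 rpred0.
  by move=> u v; rewrite mulrDr => *; rewrite rpredD.
by move=> u v Du Ev; rewrite mulrACA rpredM ?dD ?eE.
Qed.

Definition rdiv_mul (D E : rdiv) : rdiv := RDiv (rdiv_mul_subproof D E).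

Lemma rdiv_one_subproof : divisorial [set x | x \in A].
Proof.
have AE : colon [set x | x \in A] = [set x | x \in A].
  apply/seteqP; split=> z /=.
    by move=> [_ /(_ 1)]; rewrite mulr1; apply; rewrite /= rpred1.
  by move=> Az; split; [exact: Frac_A|move=> x Ax; rewrite rpredM].
split; last by rewrite !AE.
split.
- split; first by move=> x; exact: Frac_A.
  by exists 1; rewrite /= ?rpred1 ?oner_eq0.
- by move=> x y Ax Ay; rewrite /= rpredD.
- by move=> q x Aq Ax; rewrite /= rpredM.
- by exists 1; [rewrite rpred1 oner_eq0|move=> x; rewrite mul1r].
Qed.

Definition rdiv_one : rdiv := RDiv rdiv_one_subproof.

Definition rdiv_equiv (D E : rdiv) : bool :=
  `[< exists2 c, Frac c /\ c != 0 & rdiv_set D = scale c E >].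

Lemma rdiv_mulC : commutative rdiv_mul.
Proof. by move=> D E; apply: rdiv_inj; rewrite /= ideal_mulC. Qed.

Lemma rdiv_mulA : associative rdiv_mul.
Proof.
move=> D E F; apply: rdiv_inj => /=; congr colon.
have gDE : ideal_mul D E `<=` Frac by apply: ideal_mul_Frac; exact: rdiv_Frac.
have gEF : ideal_mul E F `<=` Frac by apply: ideal_mul_Frac; exact: rdiv_Frac.
rewrite ideal_mulC !colon_mul //; try exact: rdiv_Frac.
by rewrite ideal_mulC ideal_mulA.
Qed.

Lemma rdiv_mul1 : left_id rdiv_one rdiv_mul.
Proof.
move=> D; apply: rdiv_inj => /=.
suff -> : ideal_mul [set x | x \in A] D = D by exact: rdivK.
case: D => D [[[Dg [w Dw w0]] DD AD dD] DK] /=.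
apply/seteqP; split.
  apply: ideal_mul_ind => //.
  by rewrite -(mul0r w); apply: AD => //; exact: rpred0.
by move=> z Dz; rewrite -(mul1r z); apply: ideal_mulM => //=; exact: rpred1.
Qed.

Lemma rdiv_equiv_refl : reflexive rdiv_equiv.
Proof.
move=> D; apply/asboolP; exists 1.
  by split; [apply: Frac_A; exact: rpred1|exact: oner_neq0].
apply/seteqP; split=> [x Dx|_ [x Dx <-]]; last by rewrite mul1r.
by exists x => //; rewrite mul1r.
Qed.

Lemma rdiv_equiv_sub (D E : rdiv) : rdiv_equiv D E -> rdiv_equiv E D.
Proof.
move=> /asboolP [m [gm m0] DE]; apply/asboolP; exists m^-1.
  by split; [exact: FracV|rewrite invr_eq0].
rewrite DE; apply/seteqP; split=> [x Ex|_ [_ [x Ex <-] <-]].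
  by exists (m * x); [exists x|rewrite mulKf].
by rewrite mulKf.
Qed.

Lemma rdiv_equiv_sym : ssrbool.symmetric rdiv_equiv.
Proof. by move=> D E; apply/idP/idP; exact: rdiv_equiv_sub. Qed.

Lemma rdiv_equiv_trans : transitive rdiv_equiv.
Proof.
move=> E D F /asboolP [m [gm m0] DE] /asboolP [p [gp p0] EF]; apply/asboolP.
exists (m * p); first by split; [exact: FracM|rewrite mulf_neq0].
rewrite DE EF; apply/seteqP; split=> [_ [_ [x Fx <-] <-]|_ [x Fx <-]].
  by exists x => //; rewrite mulrA.
by exists (p * x); [exists x|rewrite mulrA].
Qed.

Canonical rdiv_equiv_rel :=
  EquivRel rdiv_equiv rdiv_equiv_refl rdiv_equiv_sym rdiv_equiv_trans.

Lemma colon_scale m I : Frac m -> m != 0 ->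
  colon (scale m I) = scale m^-1 (colon I).
Proof.
move=> gm m0; apply/seteqP; split=> [z [gz mI]|_ [z [gz Iz] <-]].
  exists (m * z); last by rewrite mulKf.
  split; first exact: FracM.
  by move=> x Ix; rewrite -mulrA mulrCA; apply: mI; exists x.
split; first by apply: FracM => //; exact: FracV.
move=> _ [x Ix <-].
by rewrite [m^-1 * z]mulrC -mulrA mulKf //; exact: Iz.
Qed.

Lemma rdiv_equiv_mul D D' E :
  rdiv_equiv D D' -> rdiv_equiv (rdiv_mul D E) (rdiv_mul D' E).
Proof.
move=> /asboolP [m [gm m0] DE]; apply/asboolP; exists m => //=; rewrite DE.
have -> : ideal_mul (scale m D') E = scale m (ideal_mul D' E).
  apply/seteqP; split.
    apply: ideal_mul_ind.
    - by exists 0; [exact: ideal_mul0|rewrite mulr0].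
    - move=> _ _ [x Hx <-] [y Hy <-].
      by exists (x + y); [exact: ideal_mulD|rewrite mulrDr].
    - move=> _ y [x Dx <-] Ey.
      by exists (x * y); [exact: ideal_mulM|rewrite mulrA].
  move=> _ [z + <-]; move: z; apply: ideal_mul_ind.
  - by rewrite mulr0; exact: ideal_mul0.
  - by move=> x y; rewrite mulrDr; exact: ideal_mulD.
  - by move=> x y Dx Ey; rewrite mulrA; apply: ideal_mulM => //; exists x.
by rewrite !colon_scale ?invrK ?invr_eq0 //; exact: FracV.
Qed.

Definition rClass : Type := {eq_quot rdiv_equiv}.
HB.instance Definition _ := Choice.on rClass.
HB.instance Definition _ := EqQuotient.on rClass.

Definition rclass (D : rdiv) : rClass := \pi_rClass D.

Lemma rclassP (D E : rdiv) : rclass D = rclass E <->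
  exists2 c, Frac c /\ c != 0 & rdiv_set D = scale c E.
Proof.
split=> [/eqquotP /asboolP //|DE]; apply/eqquotP; exact/asboolP.
Qed.

Definition rClass_add (x y : rClass) : rClass :=
  rclass (rdiv_mul (repr x) (repr y)).

Lemma rclassM (D E : rdiv) :
  rClass_add (rclass D) (rclass E) = rclass (rdiv_mul D E).
Proof.
have reprE F : rdiv_equiv (repr (rclass F)) F.
  by apply/(@eqquotP _ _ rClass); rewrite reprK.
apply/eqquotP; apply: (@rdiv_equiv_trans (rdiv_mul D (repr (rclass E)))).
  exact: rdiv_equiv_mul.
by rewrite ![rdiv_mul D _]rdiv_mulC; exact: rdiv_equiv_mul.
Qed.

Lemma rclass_repr (x : rClass) : rclass (repr x) = x.
Proof. exact: reprK. Qed.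

Lemma rClass_addA : associative rClass_add.
Proof.
move=> x y z; rewrite -(rclass_repr x) -(rclass_repr y) -(rclass_repr z).
by rewrite !rclassM rdiv_mulA.
Qed.

Lemma rClass_addC : commutative rClass_add.
Proof.
move=> x y; rewrite -(rclass_repr x) -(rclass_repr y).
by rewrite !rclassM rdiv_mulC.
Qed.

Lemma rClass_add0 : left_id (rclass rdiv_one) rClass_add.
Proof. by move=> x; rewrite -(rclass_repr x) rclassM rdiv_mul1. Qed.

HB.instance Definition _ :=
  GRing.isNmodule.Build rClass rClass_addA rClass_addC rClass_add0.

End RingClassGroup.

Section IntersectionAlgebra.
Variables (k : fieldType) (n : nat).
Local Notation R := {mpoly k[n]}.
(* [R[u, v]] is [R[u][v]]: [v] is ['X], [u] is ['X%:P], and the coefficient of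
   [u ^ r v ^ s] in [f] is [f`_s`_r]. *)
Local Notation Ruv := {poly {poly R}}.
Local Notation K := {fraction Ruv}.

Definition principal_ideal (g : R) : set R := [set f | exists h, f = h * g].

Fixpoint ideal_exp (I : set R) (r : nat) : set R :=
  if r is r'.+1 then ideal_mul I (ideal_exp I r') else setT.

Definition monomial_ideal (a : 'I_n -> nat) : set R :=
  principal_ideal (\prod_(i < n) 'X_i ^+ a i).

Variables a b : 'I_n -> nat.

Definition intersection_algebra : set Ruv :=
  [set f : Ruv | forall r s : nat,
     (ideal_exp (monomial_ideal a) r `&` ideal_exp (monomial_ideal b) s)
       f`_s`_r].

Lemma principal_idealD g f f' : principal_ideal g f -> principal_ideal g f' ->
  principal_ideal g (f + f').
Proof. by move=> [h ->] [h' ->]; exists (h + h'); rewrite mulrDl. Qed.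

Lemma ideal_expD I r f g :
  ideal_exp I r f -> ideal_exp I r g -> ideal_exp I r (f + g).
Proof. by case: r => //= r; exact: ideal_mulD. Qed.

Lemma ideal_exp0 I r : ideal_exp I r 0.
Proof. by case: r => //= r; exact: ideal_mul0. Qed.

Lemma ideal_expZ g r c f : ideal_exp (principal_ideal g) r f ->
  ideal_exp (principal_ideal g) r (c * f).
Proof.
case: r => //= r; move: f; apply: ideal_mul_ind.
- by rewrite mulr0; exact: ideal_mul0.
- by move=> x y; rewrite mulrDr; exact: ideal_mulD.
- move=> x y [h ->] Hy; rewrite mulrA mulrA; apply: ideal_mulM => //.
  by exists (c * h).
Qed.

Lemma ideal_expM g r s f f' :
  ideal_exp (principal_ideal g) r f -> ideal_exp (principal_ideal g) s f' ->
  ideal_exp (principal_ideal g) (r + s)%N (f * f').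
Proof.
elim: r f => [|r IHr] f Hf Hf'; first by rewrite add0n; exact: ideal_expZ.
move: f Hf; rewrite addSn /=; apply: ideal_mul_ind.
- by rewrite mul0r; exact: ideal_mul0.
- by move=> x y; rewrite mulrDl; exact: ideal_mulD.
- by move=> x y Ix Hy; rewrite -mulrA; apply: ideal_mulM => //; exact: IHr.
Qed.

Lemma ideal_exp_sum g r (T : Type) (t : seq T) (P : pred T) (F : T -> R) :
  (forall i, P i -> ideal_exp (principal_ideal g) r (F i)) ->
  ideal_exp (principal_ideal g) r (\sum_(i <- t | P i) F i).
Proof.
by move=> HF; apply: big_ind => //; [exact: ideal_exp0|exact: ideal_expD].
Qed.

Lemma intersection_algebra1 : intersection_algebra 1.
Proof.
move=> r s; rewrite coef1; case: s => [|s].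
  by rewrite coef1; case: r => [|r]; split=> //; exact: ideal_mul0.
by rewrite coef0; split; exact: ideal_exp0.
Qed.

Lemma intersection_algebraB f g : intersection_algebra f ->
  intersection_algebra g -> intersection_algebra (f - g).
Proof.
move=> Hf Hg r s; rewrite !coefB -mulN1r.
by have [? ?] := Hf r s; have [? ?] := Hg r s; split;
  apply: ideal_expD => //; exact: ideal_expZ.
Qed.

Lemma intersection_algebraM f g : intersection_algebra f ->
  intersection_algebra g -> intersection_algebra (f * g).
Proof.
move=> Hf Hg r s; rewrite coefM coef_sum; split; apply: ideal_exp_sum => j _;
  rewrite coefM; apply: ideal_exp_sum => i _.
- have [Hi _] := Hf i j; have [Hi' _] := Hg (r - i)%N (s - j)%N.
  by have := ideal_expM Hi Hi'; rewrite subnKC // -ltnS.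
- have [_ Hi] := Hf i j; have [_ Hi'] := Hg (r - i)%N (s - j)%N.
  by have := ideal_expM Hi Hi'; rewrite subnKC // -ltnS.
Qed.

(* The intersection algebra, as a subring of [Frac (R[u, v])]. *)
Definition interB : pred K :=
  [pred z | `[< exists2 f, intersection_algebra f & z = tofrac f >]].

Lemma interB_subring : GRing.subring_closed interB.
Proof.
split; first by apply/asboolP; exists 1; [exact: intersection_algebra1|rewrite rmorph1].
- move=> _ _ /asboolP[f Hf ->] /asboolP[g Hg ->]; apply/asboolP.
  by exists (f - g); [exact: intersection_algebraB|rewrite rmorphB].
- move=> _ _ /asboolP[f Hf ->] /asboolP[g Hg ->]; apply/asboolP.
  by exists (f * g); [exact: intersection_algebraM|rewrite rmorphM].
Qed.

HB.instance Definition _ := GRing.isSubringClosed.Build K interB interB_subring.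

(* [(r, s, t)] stands for [(r, s, t_1, ..., t_n)] in [Z ^ (n + 2)]. *)
Local Notation L := (int * int * 'rV[int]_n)%type.

Definition semigroupQ : pred L :=
  [pred m : L | [&& 0 <= m.1.1, 0 <= m.1.2 &
     [forall i, (0 <= m.2 0 i) &&
        (Num.max ((a i)%:Z * m.1.1) ((b i)%:Z * m.1.2) <= m.2 0 i)]]].

Lemma semigroupQ_closed : Algebra.addumagma_closed semigroupQ.
Proof.
split.
  apply/forallP => i.
  by rewrite mxE !mulr0 ge_max lexx.
move=> [[r s] t] [[r' s'] t'] /and3P[/= r0 s0 /forallP Ht].
move=> /and3P[/= r0' s0' /forallP Ht']; rewrite unfold_in /=.
rewrite !addr_ge0 //=; apply/forallP => i; rewrite !mxE.
have /andP[t0] := Ht i; have /andP[t0'] := Ht' i.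
rewrite !ge_max => /andP[h1 h2] /andP[h3 h4].
by rewrite addr_ge0 //= !mulrDr !lerD.
Qed.

HB.instance Definition _ := Algebra.isAddClosed.Build L semigroupQ semigroupQ_closed.

(* The Laurent monomial [u ^ r v ^ s x_1 ^ t_1 ... x_n ^ t_n]. *)
Definition laurent (m : L) : K :=
  tofrac ('X%:P : Ruv) ^ m.1.1 * tofrac ('X : Ruv) ^ m.1.2 *
  \prod_(i < n) tofrac (('X_i : R)%:P%:P : Ruv) ^ (m.2 0 i).

Definition kspan (M : set L) : set K :=
  [set z | exists2 s : seq (k * L), (forall p, p \in s -> M p.2) &
     z = \sum_(p <- s) tofrac ((p.1%:MP : R)%:P%:P : Ruv) * laurent p.2].

Definition fan_ordered : Prop :=
  forall i j : 'I_n, j = i.+1 :> nat ->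
    (a j)%:R / (b j)%:R <= (a i)%:R / (b i)%:R :> rat.

End IntersectionAlgebra.

Section ClassGroups.
Variables (k : fieldType) (n : nat) (a b : 'I_n -> nat).

Definition Q : addrClosed (int * int * 'rV[int]_n)%type :=
  Algebra.AddClosed.clone _ (semigroupQ a b) _.

Definition B : subringClosed {fraction {poly {poly {mpoly k[n]}}}} :=
  GRing.SubringClosed.clone _ (@interB k n a b) _.

Definition ClQ : nmodType := mClass Q.

Definition ClB : nmodType := rClass B.

(* [M |-> kspan M], [k]-span of the monomials with exponent in [M], carries
   divisorial ideals of [Q] to divisorial ideals of [B] and induces [Phi]. *)
Definition natural_map (Phi : ClQ -> ClB) : Prop :=
  forall D : mdiv Q,
    exists2 E : rdiv B, rdiv_set E = kspan D & Phi (mclass D) = rclass E.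

End ClassGroups.

(* Main.v *)
Require Import Defs.
From HB Require Import structures.
From mathcomp Require Import all_boot all_order all_algebra.
From mathcomp Require Import generic_quotient fraction.
From mathcomp Require Import mpoly zify ring.
From mathcomp Require Import boolp classical_sets.

Set Implicit Arguments.
Unset Strict Implicit.
Unset Printing Implicit Defensive.

Import Order.TTheory GRing.Theory Num.Theory.
Local Open Scope ring_scope.
Local Open Scope classical_set_scope.

(** Both statements rest on one description of the monoid: [Q] is the set of
    lattice points where the forms [r], [s], [t_i - a_i r], [t_i - b_i s] are
    nonnegative, and for arbitrary prescribed lower bounds on these [2n + 2]
    forms there is a lattice point meeting all bounds, with equality in any one
    chosen form ([facet_attained]).

    The class group of [Q]. By the attainment property, a divisorial ideal is
    the same thing as a vector of [2n + 2] integers: the minima of the forms on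
    it ([mdiv_ordE], [ord_surj]). Minima add up under multiplication of ideals
    ([ord_mul]) and translation by [m] adds the values of the forms at [m]
    ([mclass_ordP]), so that the class group is the cokernel of the map
    [Z^(n+2) -> Z^(2n+2)] given by the forms. That cokernel is read off as
    [Z^n] by the coordinates
    [min (t_i - a_i r) - min (t_i - b_i s) + a_i min r - b_i min s].

    The class group of [B]. The algebra [B] is spanned by the monomials with
    exponent in [Q] ([B_kspan]), inside the ring [T] of Laurent polynomials.
    Colons and products of spans of monomials are spans of the colons and sums
    of the exponent sets ([colon_span], [ideal_mul_span]); hence taking spans
    sends divisorial ideals to divisorial ideals and is additive on classes.
    It is injective on classes because a factor [c] relating two spans is a
    unit of [T], and any of its monomials already relates the two ideals of
    [Q] ([span_class_inj]).

    Surjectivity is where factoriality enters. After scaling, a divisorial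
    ideal lies in [B], hence in the polynomial ring; let [g] be the greatest
    common divisor of its elements there. Once [I] is divided by [g], a
    multiplier [z] with [z I] inside [B] has no denominator left and is a
    Laurent polynomial. Comparing, for each form, the lowest parts of [z] and
    of an element of [I] ([supp_nonneg]) then shows that each monomial of [z]
    is itself a multiplier. So the colon of [I] is spanned by monomials, and
    so is [I], which is the colon of its colon ([span_class_surj]).

    Greatest common divisors of infinite families exist in a factorial domain
    ([gcd_exists]), and polynomial rings over a field are factorial by Gauss
    ([factorial_poly], [factorial_mpoly]). *)

(** * Factorial domains and greatest common divisors *)

Section Factorial.
Variable A : idomainType.
Implicit Types (a b c p q x y z : A).

Definition divides a b := exists q, b = q * a.

Definition prime_elt p :=
  [/\ p != 0, p \isn't a GRing.unit
    & forall a b, divides p (a * b) -> divides p a \/ divides p b].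

(** An inductive predicate instead of a list of primes, so that one prime can
    be cancelled at each step of an induction. *)
Inductive factors : A -> Prop :=
| factors_unit u : u \is a GRing.unit -> factors u
| factors_prime p x : prime_elt p -> factors x -> factors (p * x).

Definition factorial_dom := forall x, x != 0 -> factors x.

Lemma divides_trans a b c : divides a b -> divides b c -> divides a c.
Proof. by move=> [q ->] [r ->]; exists (r * q); rewrite mulrA. Qed.

Lemma divides_mull a b c : divides a b -> divides a (c * b).
Proof. by move=> [q ->]; exists (c * q); rewrite mulrA. Qed.

Lemma divides_mulr a b c : divides a b -> divides a (b * c).
Proof. by rewrite mulrC; exact: divides_mull. Qed.

Lemma divides_refl a : divides a a.
Proof. by exists 1; rewrite mul1r. Qed.

Lemma divides_unit a u : u \is a GRing.unit -> divides a u ->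
  a \is a GRing.unit.
Proof. by move=> uU [q uE]; move: uU; rewrite uE unitrM => /andP[]. Qed.

Lemma unit_divides a u : u \is a GRing.unit -> divides u a.
Proof. by move=> uU; exists (a / u); rewrite divrK. Qed.

Lemma factorsM x y : factors x -> factors y -> factors (x * y).
Proof.
move=> Fx Fy; elim: Fx => [u uU|p z pP _ IH]; last first.
  by rewrite -mulrA; exact: factors_prime.
elim: Fy => [v vU|p z pP _ IH]; first by apply: factors_unit; rewrite unitrM uU.
by rewrite mulrCA; exact: factors_prime.
Qed.

(** A prime factor of [y] fails to divide some [x] in [J], so it divides [w]
    and can be cancelled from [y] and [w]. *)
Lemma coprime_divides (J : A -> Prop) y w : factors y ->
  (forall p, prime_elt p -> exists2 x, J x & ~ divides p x) ->
  (forall x, J x -> divides y (w * x)) -> divides y w.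
Proof.
move=> Fy cop; elim: Fy w => [u uU|p z pP _ IH] w Jw; first exact: unit_divides.
have [x Jx px] := cop p pP.
have [p0 _ pM] := pP.
have [[v wE]|//] : divides p w \/ divides p x.
  by apply: pM; apply: divides_trans (Jw x Jx); exists z; rewrite mulrC.
suff [r vE] : divides z v by exists r; rewrite wE vE mulrAC mulrA.
apply: IH => x' /Jw [s]; rewrite wE => e; exists s.
by apply: (mulIf p0); rewrite mulrAC e mulrAC mulrA.
Qed.

Lemma prime_divides_prime p q : prime_elt p -> prime_elt q ->
  divides p q -> divides q p.
Proof.
move=> [p0 pU _] [q0 qU qM] [r qE].
have : divides q (r * p) by rewrite -qE; exact: divides_refl.
case/qM=> // -[s rE]; case/negP: pU.
apply: (@divides_unit _ 1); first exact: unitr1.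
by exists s; apply: (mulIf q0); rewrite mul1r {1}qE rE mulrAC.
Qed.

(** The second clause says that a fraction [w / y] multiplying [J] into the
    domain also multiplies [g] into it; this is stronger than being divisible
    by all common divisors, and is what colon ideals require. *)
Definition is_gcd (J : A -> Prop) g :=
  (forall x, J x -> divides g x) /\
  forall y w, y != 0 -> (forall x, J x -> divides y (w * x)) ->
    divides y (w * g).

End Factorial.

Section Gcd.
Variable A : idomainType.
Hypothesis factA : factorial_dom A.
Implicit Types (a b c p q x y z : A).

(** The primes of [x] are examined one at a time. Each either divides all of
    [J], and then [J] is divided by it, or fails to, and then it moves into the
    part [y], none of whose primes divides all of [J]. When [x] is used up, a
    prime common to all of [J] would divide the member [x * y], hence [y]; so
    there is none. *)
Lemma gcd_exists_mul x y : factors x ->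
  forall J : A -> Prop, J (x * y) -> x * y != 0 -> 
  (forall p, prime_elt p -> divides p y -> exists2 z, J z & ~ divides p z) ->
  exists g, is_gcd J g.
Proof.
move=> Fx; elim: Fx y => [u uU|p {}x pP _ IH] y J Jxy xy0 cop.
  exists 1; split=> [z _|z w z0 Jz]; first by apply: unit_divides; exact: unitr1.
  rewrite mulr1; apply: (coprime_divides (factA z0)) Jz => p pP.
  have [/(cop p pP)//|pu] := pselect (divides p y).
  exists (u * y) => //; case: pP => [_ pU pM] /pM [] // /(divides_unit uU).
  exact/negP.
have [p0 pU pM] := pP.
have [pJ|/existsNP[z /not_implyP[Jz pz]]] :=
    pselect (forall z, J z -> divides p z); last first.
  apply: (IH (p * y) J); rewrite 1?mulrCA 1?mulrA //.
  move=> q qP qpy; have [_ _ qM] := qP.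
  case: (qM _ _ qpy) => [qp|]; last exact: cop.
  exists z => // qz; apply: pz.
  exact: divides_trans (prime_divides_prime qP pP qp) qz.
have [|||g [gJ gP]] := IH y (fun z => J (p * z)); rewrite ?mulrA //.
- by move: xy0; rewrite -mulrA mulf_eq0 negb_or => /andP[].
- move=> q qP qy; have [z Jz qz] := cop q qP qy.
  have [r zE] := pJ z Jz; rewrite zE in Jz qz; exists r; rewrite 1?mulrC //.
  by move=> /(divides_mulr p).
exists (p * g); split=> [z Jz|y' w y0 Jw].
  have [r zE] := pJ z Jz; rewrite zE mulrC in Jz *.
  by have [s ->] := gJ r Jz; exists s; rewrite mulrCA.
by rewrite mulrA; apply: gP => // x' Jx'; rewrite -mulrA; exact: Jw.
Qed.

Lemma gcd_exists (J : A -> Prop) x : J x -> x != 0 -> exists g, is_gcd J g.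
Proof.
move=> Jx x0; apply: (@gcd_exists_mul x 1); rewrite ?mulr1 //; first exact: factA.
move=> p [_ /negP pU _] /divides_unit.
by rewrite unitr1 => /(_ isT).
Qed.

End Gcd.

(** * Gauss: polynomial rings over a field are factorial *)

Lemma factorial_iso (A B : idomainType) (f : {rmorphism A -> B}) :
  bijective f -> factorial_dom B -> factorial_dom A.
Proof.
move=> [g fK gK] factB x x0.
have finj := can_inj fK.
have fdiv u v : divides (f u) (f v) -> divides u v.
  by move=> [q e]; exists (g q); apply: finj; rewrite rmorphM gK.
have divf u v : divides u v -> divides (f u) (f v).
  by move=> [q ->]; exists (f q); rewrite rmorphM.
have funit u : f u \is a GRing.unit -> u \is a GRing.unit.
  move=> fu; apply: (@divides_unit _ _ 1); first exact: unitr1.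
  by apply: fdiv; rewrite rmorph1; exact: unit_divides.
have : factors (f x) by apply: factB; rewrite -(rmorph0 f) (inj_eq finj).
move: {2}(f x) (erefl (f x)) => y xE.
rewrite xE => Fy; elim: Fy x {x0} xE => [u uU|p z [p0 pU pM] _ IH] x xE.
  by apply: factors_unit; apply: funit; rewrite xE.
have -> : x = g p * g z by apply: finj; rewrite rmorphM !gK.
apply: factors_prime; last by apply: IH; rewrite gK.
split.
- by apply: contra_neq p0 => gp0; rewrite -(gK p) gp0 rmorph0.
- by apply: contraNN pU => /(rmorph_unit f); rewrite gK.
- move=> a b /divf; rewrite gK rmorphM => /pM.
  by rewrite -{1 2}(gK p) => -[] /fdiv; [left|right].
Qed.

Section Gauss.
Variable A : idomainType.
Hypothesis factA : factorial_dom A.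
Implicit Types (c p q : A) (f g h r : {poly A}).

Lemma dividesC_coef p f : divides p%:P f <-> forall i, divides p f`_i.
Proof.
split=> [[q ->] i|pf]; first by exists q`_i; rewrite coefMC.
have [q qE] := choice pf.
exists (\poly_(i < size f) q i); apply/polyP => i; rewrite coefMC coef_poly.
by case: ltnP => fi; [exact: qE|rewrite mul0r nth_default].
Qed.

Lemma divides_sum (I : Type) (s : seq I) (P : pred I) (F : I -> A) p :
  (forall i, P i -> divides p (F i)) -> divides p (\sum_(i <- s | P i) F i).
Proof.
move=> pF; apply: big_ind => //; first by exists 0; rewrite mul0r.
by move=> _ _ [q ->] [r ->]; exists (q + r); rewrite mulrDl.
Qed.

Lemma divides_addr p c q : divides p q -> divides p (c + q) -> divides p c.
Proof. by move=> [r ->] [s e]; exists (s - r); rewrite mulrBl -e addrK. Qed.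

(** Gauss: if [p] divided [f g] but neither factor, the product of the first
    coefficients of [f] and [g] that it misses would be the only term of a
    coefficient of [f g] that it misses. *)
Lemma prime_polyC p : prime_elt p -> prime_elt p%:P.
Proof.
move=> [p0 pU pM]; split; first by rewrite polyC_eq0.
  apply: contra pU; rewrite poly_unitE coefC /= => /andP[] //.
have least f : ~ divides p%:P f ->
    exists i, ~ divides p f`_i /\ forall j, (j < i)%N -> divides p f`_j.
  move=> /dividesC_coef /existsNP[i0 pi0].
  have ex : exists i, `[< ~ divides p f`_i >] by exists i0; apply/asboolP.
  case: (ex_minnP ex) => i /asboolP pi imin; exists i; split=> // j ji.
  have [//|pj] := pselect (divides p f`_j).
  have /imin : `[< ~ divides p f`_j >] by apply/asboolP.
  by rewrite leqNgt ji.
move=> f g pfg; apply/or_asboolP; apply: contrapT => /negP.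
rewrite negb_or => /andP[/asboolPn /least[i [pi imin]] /asboolPn /least[j [pj jmin]]].
have /dividesC_coef/(_ (i + j)%N) := pfg.
have iij : (i < (i + j).+1)%N by rewrite ltnS leq_addr.
rewrite coefM (bigD1 (Ordinal iij)) //= addKn => pfgij.
case: (pM f`_i g`_j); [|exact: pi|exact: pj].
apply: divides_addr pfgij.
apply: divides_sum => l /eqP li.
have [lti|] := ltnP l i; first exact/divides_mulr/imin.
rewrite leq_eqVlt => /predU1P[/esym il|ltl]; first by case: li; exact/val_inj.
apply/divides_mull/jmin; have := ltn_ord l; rewrite ltnS => lij.
by rewrite ltn_subLR // ltn_add2r.
Qed.

Definition primitive f := forall p, prime_elt p -> ~ divides p%:P f.

Lemma factors_polyC c : factors c -> factors c%:P.
Proof.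
elim=> [u uU|p x pP _ IH]; first by apply: factors_unit; rewrite rmorph_unit.
by rewrite polyCM; apply: factors_prime => //; exact: prime_polyC.
Qed.

(** The prime factors of the leading coefficient are tried one at a time: [x]
    is the part still to be tried, and no prime of the part [y] already tried
    divides what is left of [f]. *)
Lemma primitive_part f : f != 0 ->
  exists c f', [/\ c != 0, f = c%:P * f' & primitive f'].
Proof.
move=> f0.
suff key x : factors x -> forall y f, lead_coef f = x * y -> f != 0 ->
    (forall q, prime_elt q -> divides q y -> ~ divides q%:P f) ->
    exists c f', [/\ c != 0, f = c%:P * f' & primitive f'].
  have lf0 : lead_coef f != 0 by rewrite lead_coef_eq0.
  apply: (key _ (factA lf0) 1) => //; first by rewrite mulr1.
  move=> q [_ /negP qU _] /divides_unit.
  by rewrite unitr1 => /(_ isT).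
elim=> {f f0 x} [u uU|p x pP _ IH] y f fE f0 cop.
  exists 1, f; split; rewrite ?oner_eq0 ?mul1r // => q qP qf.
  have : divides q (u * y) by rewrite -fE lead_coefE; move/dividesC_coef: qf; apply.
  have [_ /negP qU qM] := qP.
  by case/qM => [/(divides_unit uU)//|/cop]; apply.
have [p0 pU pM] := pP.
have [[f1 f1E]|pf] := pselect (divides p%:P f); last first.
  apply: (IH (p * y)) => //; first by rewrite fE mulrCA mulrA.
  move=> q qP; have [_ _ qM] := qP.
  case/qM => [qp|/cop]; last by apply.
  move=> qf; apply: pf; apply: divides_trans qf.
  by have [r ->] := prime_divides_prime qP pP qp; exists r%:P; rewrite polyCM.
have f10 : f1 != 0 by apply: contra_neq f0; rewrite f1E => ->; rewrite mul0r.
have [||c [f' [c0 f1E' f'P]]] := IH y f1 _ f10.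
- by apply: (mulIf p0); rewrite -{1}[p]lead_coefC -lead_coefM -f1E fE -mulrA mulrC.
- move=> q qP qy qf1; apply: (cop q qP qy); rewrite f1E.
  exact: divides_mulr.
exists (c * p), f'; split=> //; first by rewrite mulf_neq0.
by rewrite f1E f1E' polyCM mulrAC.
Qed.

(** Primes of [A] stay prime in [{poly A}], so those dividing [c] can be moved
    one at a time onto one of the factors of [c f]. *)
Lemma primitive_cancel c f g h : primitive f -> c != 0 ->
  c%:P * g = h * f -> divides f g.
Proof.
move=> fP c0; elim: (factA c0) g h => [u uU|p x pP _ IH] g h gE.
  exists (u^-1%:P * h); rewrite -mulrA -gE mulrA -polyCM mulVr //.
  by rewrite mul1r.
have [pp0 _ pM] := prime_polyC pP.
have [h' hE] : divides p%:P h.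
  case: (pM h f); rewrite -?gE; [|by []|by move=> /fP].
  by exists (x%:P * g); rewrite polyCM -mulrA mulrC.
apply: (IH g h'); apply: (mulfI pp0).
by rewrite mulrA -polyCM gE hE [in RHS]mulrCA mulrA.
Qed.

(** The primes of [c] divide [g] or [h] and are cancelled from them, so the
    factorisation of [c f] descends to [f] with the same degrees. *)
Lemma split_scaled c f g h : c != 0 -> c%:P * f = g * h ->
  exists g' h', [/\ f = g' * h', size g' = size g & size h' = size h].
Proof.
move=> c0; elim: (factA c0) g h => [u uU|p x pP _ IH] g h fE.
  exists (u^-1%:P * g), h; split=> //.
    by rewrite -mulrA -fE mulrA -polyCM mulVr // mul1r.
  by rewrite size_Cmul // invr_eq0; apply: contraTneq uU => ->; rewrite unitr0.
have [pp0 _ pM] := prime_polyC pP; have [p0 _ _] := pP.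
have : divides p%:P (g * h) by rewrite -fE polyCM -mulrA mulrC; exists (x%:P * f).
case/pM=> -[s sE].
- have [|g' [h' [-> sg sh]]] := IH s h.
    by apply: (mulfI pp0); rewrite mulrA -polyCM fE sE; rewrite mulrAC mulrC.
  by exists g', h'; split; rewrite // sE mulrC size_Cmul.
- have [|g' [h' [-> sg sh]]] := IH g s.
    by apply: (mulfI pp0); rewrite mulrA -polyCM fE sE mulrA mulrC.
  by exists g', h'; split; rewrite // sE [_ * p%:P]mulrC size_Cmul.
Qed.

(** Pseudo-divisibility over [A] is divisibility over its fraction field, where
    irreducible polynomials are prime; [split_scaled] shows that [f] stays
    irreducible there, and [primitive_cancel] brings divisibility by [f] back
    to [A]. *)
Lemma prime_primitive f : primitive f -> (1 < size f)%N ->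
  (forall g h, f = g * h -> size g = 1%N \/ size h = 1%N) -> prime_elt f.
Proof.
move=> fP f1 firr; split.
- by rewrite -size_poly_gt0; exact: ltnW.
- by rewrite poly_unitE; case: eqP f1 => // ->.
have irr (q : {poly A}) : size q != 1%N -> Pdiv.Field.dvdp q f -> Pdiv.Field.eqp q f.
  move=> q1 qf; rewrite -(Pdiv.Field.dvdp_size_eqp qf).
  have [[c r] /= c0 e] := Pdiv.WeakIdomain.dvdpP _ _ qf.
  have [|q' [r' [fE sq sr]]] := @split_scaled c f q r c0.
    by rewrite mul_polyC e mulrC.
  have [|r1] := firr _ _ fE; first by rewrite sq => /eqP; rewrite (negPf q1).
  have r0 : r' != 0 by rewrite -size_poly_gt0 r1.
  have q0 : q' != 0.
    by apply: contraTneq f1 => q0; rewrite fE q0 mul0r size_poly0.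
  by rewrite fE size_mul // r1 addn1 sq.
have back g : Pdiv.Field.dvdp f g -> divides f g.
  case/Pdiv.WeakIdomain.dvdpP => -[c r] /= c0 e.
  by apply: (@primitive_cancel c _ _ r); rewrite ?mul_polyC.
move=> g h [q ghE].
have fgh : Pdiv.Field.dvdp f (g * h) by rewrite ghE dvdp_mull.
have [gcd1|gcd1] := boolP (coprimep f g).
  by right; apply: back; rewrite -(Gauss_dvdpr _ gcd1).
left; apply: back; rewrite -(eqp_dvdl _ (irr _ gcd1 (dvdp_gcdl f g))).
exact: dvdp_gcdr.
Qed.

Lemma factorial_poly : factorial_dom {poly A}.
Proof.
move=> f; have [m] := ubnP (size f); elim: m f => // m IH f fm f0.
have [c [f' [c0 fE f'P]]] := primitive_part f0.
rewrite fE; apply: factorsM; first by apply: factors_polyC; exact: factA.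
have sf : size f' = size f by rewrite fE size_Cmul.
have f'0 : f' != 0 by rewrite -size_poly_gt0 sf size_poly_gt0.
have [f1|f1] := leqP (size f') 1.
  have [d d0 dE] : exists2 d, d != 0 & f' = d%:P.
    exists f'`_0; last exact: size1_polyC.
    by move: f'0; rewrite {1}(size1_polyC f1) polyC_eq0.
  apply: factors_unit; rewrite dE; case: (factA d0) dE => [u uU _|p x pP _ dE].
    by rewrite rmorph_unit.
  by case: (f'P p pP); exists x%:P; rewrite dE polyCM mulrC.
have [firr|] := pselect (forall g h, f' = g * h -> size g = 1%N \/ size h = 1%N).
  rewrite -[f']mulr1; apply: factors_prime; first exact: prime_primitive.
  by apply: factors_unit; exact: unitr1.
move=> /existsNP[g /existsNP[h /not_implyP[f'E /not_orP[g1 h1]]]].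
have [g0 h0] : g != 0 /\ h != 0.
  by move: f'0; rewrite f'E mulf_eq0 negb_or => /andP[].
have : (size f' < m.+1)%N by rewrite sf.
rewrite f'E size_mul // => sgh.
have sg : (0 < size g)%N by rewrite size_poly_gt0.
have sh : (0 < size h)%N by rewrite size_poly_gt0.
by apply: factorsM; apply: IH => //; lia.
Qed.

End Gauss.

Section Muni.
Variables (k : fieldType) (n : nat).

Lemma muniXE (m : 'X_{1..n.+1}) : muni ('X_[m] : {mpoly k[n.+1]}) =
  'X_[[multinom m (widen_ord (leqnSn n) i) | i < n]]%:P * 'X^(m ord_max).
Proof. by rewrite muniE msuppX big_seq1 mcoeffX eqxx scale1r mul_polyC. Qed.

Lemma muni_mwiden (c : {mpoly k[n]}) : muni (mwiden c) = c%:P.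
Proof.
elim/mpolyind: c => [|c m p _ _ IH]; first by rewrite !rmorph0.
rewrite !rmorphD /= IH mwidenZ muniZ mwidenX muniXE mnmwiden_ordmax mulr1.
rewrite -mul_polyC -polyCM mul_mpolyC.
have -> // : [multinom mnmwiden m (widen_ord (leqnSn n) i) | i < n] = m.
by apply/mnmP => i; rewrite mnmE mnmwiden_widen.
Qed.

Lemma muni_X : muni ('X_ord_max : {mpoly k[n.+1]}) = 'X.
Proof.
rewrite muniXE mnmE eqxx expr1 -[RHS]mul1r; congr (_%:P * _).
rewrite -mpolyX0; congr 'X_[_]; apply/mnmP => i; rewrite !mnmE.
by apply/eqP; rewrite eqb0 -val_eqE /= gtn_eqF.
Qed.

Lemma muni_bij : bijective (@muni n k).
Proof.
exists (fun p => (map_poly (@mwiden n k) p).['X_ord_max]) => [p|p].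
  elim/mpolyind: p => [|c m p _ _ IH]; first by rewrite muni0 rmorph0 horner0.
  rewrite muniD muniZ rmorphD hornerD IH; congr (_ + _).
  rewrite -mul_polyC rmorphM /= map_polyC hornerCM /= mwidenC mul_mpolyC.
  congr (_ *: _).
  rewrite muniXE rmorphM /= map_polyC map_polyXn hornerCM hornerXn /= mwidenX.
  rewrite [RHS]mpolyXE_id big_ord_recr /=; congr (_ * _).
  rewrite mpolyXE_id big_ord_recr /= mnmwiden_ordmax expr0 mulr1.
  by apply: eq_bigr => i _; rewrite mnmwiden_widen mnmE.
rewrite -horner_map /= muni_X -map_poly_comp -[RHS]comp_polyXr.
by rewrite /comp_poly; congr _.['X]; apply: eq_map_poly => c; exact: muni_mwiden.
Qed.

End Muni.

Lemma factorial_mpoly (k : fieldType) n : factorial_dom {mpoly k[n]}.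
Proof.
elim: n => [|n IH].
  move=> p p0; apply: factors_unit.
  have pE : p = (p@_0)%:MP.
    apply/mpolyP => m; rewrite mcoeffC.
    by have -> : m = 0%MM by [apply/mnmP => -[]]; rewrite eqxx mulr1.
  rewrite pE rmorph_unit // unitfE; apply: contra_neq p0 => p0.
  by rewrite pE p0 mpolyC0.
apply: (factorial_iso (f := @muni n k)); first exact: muni_bij.
exact: factorial_poly.
Qed.

(** * Spans of monomials in a field *)

Lemma seq_min (T : eqType) (F : T -> int) (s : seq T) : s != [::] ->
  exists2 x, x \in s & forall y, y \in s -> F x <= F y.
Proof.
elim: s => // x [|y s] IH _.
  by exists x => [|z]; rewrite ?inE // => /eqP->.
have [//|m ms mP] := IH _.
have [xm|mx] := leP (F x) (F m).
  exists x => [|z]; rewrite inE ?eqxx // => /predU1P[->//|/mP].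
  exact: le_trans.
exists m => [|z]; first by rewrite inE ms orbT.
by rewrite inE => /predU1P[->|/mP //]; exact: ltW.
Qed.

(** Abstractly, [X] identifies the group algebra of [L] over [k] with a subring
    of the field [K], which is [mspan setT]. *)
Section Span.
Variables (k K : fieldType) (L : zmodType).
Variables (kap : {rmorphism k -> K}) (X : L -> K).
Implicit Types (s : seq (k * L)) (l m : L) (M N : set L) (z w : K).

Definition mcomb s : K := \sum_(p <- s) kap p.1 * X p.2.
Definition lcoef s l : k := \sum_(p <- s | p.2 == l) p.1.

Definition mspan M : set K :=
  [set z | exists2 s, (forall p, p \in s -> M p.2) & z = mcomb s].

(** A relation instead of a coefficient function: by freeness every expansion
    of [z] gives the same coefficients ([in_suppE]), and elements outside the
    group algebra have empty support. *)
Definition in_supp z l : Prop := exists2 s, z = mcomb s & lcoef s l != 0.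

Hypothesis X0 : X 0 = 1.
Hypothesis XD : forall l m, X (l + m) = X l * X m.
Hypothesis X_free : forall s, mcomb s = 0 -> forall l, lcoef s l = 0.

Lemma XVK m : X (- m) * X m = 1.
Proof. by rewrite -XD addNr X0. Qed.

Lemma X_neq0 m : X m != 0.
Proof.
by apply: contra_eq_neq (XVK m) => ->; rewrite mulr0 eq_sym oner_eq0.
Qed.

Lemma mcomb_cat s s' : mcomb (s ++ s') = mcomb s + mcomb s'.
Proof. by rewrite /mcomb big_cat. Qed.

Lemma mspanS M N : M `<=` N -> mspan M `<=` mspan N.
Proof. by move=> MN z [s sM ->]; exists s => // p /sM /MN. Qed.

Lemma mspan0 M : mspan M 0.
Proof. by exists [::] => //; rewrite /mcomb big_nil. Qed.

Lemma mspanD M z w : mspan M z -> mspan M w -> mspan M (z + w).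
Proof.
move=> [s sM ->] [s' sM' ->]; exists (s ++ s'); last by rewrite mcomb_cat.
by move=> p; rewrite mem_cat => /orP[/sM|/sM'].
Qed.

Lemma mspan_term M c m : M m -> mspan M (kap c * X m).
Proof.
move=> Mm; exists [:: (c, m)]; last by rewrite /mcomb big_seq1.
by move=> p; rewrite inE => /eqP->.
Qed.

Lemma mspan_X M m : M m -> mspan M (X m).
Proof. by rewrite -[X m]mul1r -(rmorph1 kap); exact: mspan_term. Qed.

Lemma mspan_ind M (P : K -> Prop) : P 0 ->
  (forall z w, P z -> P w -> P (z + w)) ->
  (forall c m, M m -> P (kap c * X m)) -> forall z, mspan M z -> P z.
Proof.
move=> P0 PD PX _ [s sM ->]; rewrite /mcomb big_seq.
by apply: big_ind => // p /sM; exact: PX.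
Qed.

Lemma mspanM M N z w : mspan M z -> mspan N w -> mspan (msum M N) (z * w).
Proof.
move=> zM wN; elim/mspan_ind: zM => [|z1 z2|c m Mm].
- by rewrite mul0r; exact: mspan0.
- by rewrite mulrDl; exact: mspanD.
elim/mspan_ind: wN => [|w1 w2|d n Nn].
- by rewrite mulr0; exact: mspan0.
- by rewrite mulrDr; exact: mspanD.
by rewrite mulrACA -rmorphM -XD; apply: mspan_term; exists m, n.
Qed.

Lemma mspanN M z : mspan M z -> mspan M (- z).
Proof.
move=> zM; elim/mspan_ind: zM => [|z1 z2|c m Mm].
- by rewrite oppr0; exact: mspan0.
- by rewrite opprD; exact: mspanD.
- by rewrite -mulNr -rmorphN; exact: mspan_term.
Qed.

Lemma mcomb_grouped s :
  mcomb s = \sum_(l <- undup [seq p.2 | p <- s]) kap (lcoef s l) * X l.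
Proof.
under eq_bigr do rewrite rmorph_sum mulr_suml big_mkcond /=.
rewrite exchange_big /mcomb; apply: eq_big_seq => p ps /=.
rewrite (bigD1_seq p.2) ?undup_uniq ?mem_undup ?map_f //= eqxx.
rewrite big1 ?addr0 // => l /negPf; rewrite eq_sym => ->.
by [].
Qed.

Lemma lcoef_inj s s' l : mcomb s = mcomb s' -> lcoef s l = lcoef s' l.
Proof.
move=> e; apply/eqP; rewrite -subr_eq0; apply/eqP.
have := @X_free (s ++ [seq (- p.1, p.2) | p <- s']).
rewrite mcomb_cat e /mcomb big_map /= -[X in _ + X](_ : - \sum_(p <- s') kap p.1 * X p.2 = _).
  by rewrite subrr => /(_ erefl l); rewrite /lcoef big_cat big_map /= sumrN.
by rewrite -sumrN; apply: eq_bigr => p _; rewrite rmorphN mulNr.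
Qed.

Lemma in_suppE s l : in_supp (mcomb s) l <-> lcoef s l != 0.
Proof.
split=> [[s' e]|sl]; last by exists s.
by rewrite (lcoef_inj l e).
Qed.

Lemma mspanP M z : mspan setT z -> mspan M z <-> (in_supp z `<=` M).
Proof.
move=> [s0 _ z0]; split=> [[s sM ->] l /in_suppE|].
  move=> sl; apply: contrapT => nMl; move/negP: sl; apply; apply/eqP.
  rewrite /lcoef big_seq_cond big1 // => p /andP[/sM Mp /eqP pl].
  by case: nMl; rewrite -pl.
rewrite z0 => sM; rewrite mcomb_grouped big_seq.
apply: big_ind => [||l _]; [exact: mspan0|exact: mspanD|].
have [->|sl] := eqVneq (lcoef s0 l) 0.
  by rewrite rmorph0 mul0r; exact: mspan0.
by apply: mspan_term; apply: sM; apply/in_suppE.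
Qed.

Lemma mspanT M z : mspan M z -> mspan setT z.
Proof. exact: mspanS. Qed.

Lemma mspanTM z w : mspan setT z -> mspan setT w -> mspan setT (z * w).
Proof. by move=> Tz Tw; apply: mspanT (mspanM Tz Tw). Qed.

Lemma mspan_supp z : mspan setT z -> mspan (in_supp z) z.
Proof. by move=> Tz; apply/mspanP. Qed.

Lemma mspan_set0 z : mspan set0 z -> z = 0.
Proof. by move=> z0; elim/mspan_ind: z0 => // u v -> ->; rewrite addr0. Qed.

Lemma supp_neq0 z : mspan setT z -> z != 0 -> in_supp z !=set0.
Proof.
move=> Tz z0; apply/set0P; apply: contra_neq z0 => z0.
by apply: mspan_set0; rewrite -z0; exact: mspan_supp.
Qed.

Lemma suppM z w : mspan setT z -> mspan setT w ->
  in_supp (z * w) `<=` msum (in_supp z) (in_supp w).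
Proof.
move=> Tz Tw; have := mspanM (mspan_supp Tz) (mspan_supp Tw).
by move=> zw; apply/mspanP => //; exact: mspanT zw.
Qed.

Lemma mspanTX m z : mspan setT (X m * z) -> mspan setT z.
Proof.
move=> /(mspanM (mspan_X (I : setT (- m)))); rewrite mulrA XVK mul1r.
exact: mspanT.
Qed.

Lemma in_supp_X m : in_supp (X m) `<=` [set m].
Proof. by apply/mspanP; apply: mspan_X. Qed.

Lemma supp_mulX m z l : mspan setT z -> in_supp z l -> in_supp (X m * z) (m + l).
Proof.
move=> Tz zl.
have TXz : mspan setT (X m * z) by apply: mspanTM => //; exact: mspan_X.
have : in_supp (X (- m) * (X m * z)) l by rewrite mulrA XVK mul1r.
case/(suppM (mspan_X (I : setT _)) TXz) => _ [l' [/in_supp_X -> zl' ->]].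
by rewrite addNKr.
Qed.

(** As the coefficient of [1] at [0] is nonzero, some product of a monomial of
    [z] by a monomial of [w] is [1]. *)
Lemma supp_inverse z w : mspan setT z -> mspan setT w -> z * w = 1 ->
  exists2 m, in_supp z m & in_supp w (- m).
Proof.
move=> Tz Tw zw1.
have : in_supp (z * w) 0.
  exists [:: (1, 0)]; first by rewrite /mcomb big_seq1 X0 rmorph1 mulr1.
  by rewrite /lcoef big_mkcond big_seq1 eqxx oner_eq0.
case/(suppM Tz Tw) => m [m' [zm wm' mm']]; exists m => //.
suff -> : - m = m' by [].
by apply/eqP; rewrite eq_sym -addr_eq0 addrC -mm'.
Qed.

(** [z0] is the initial part of [z], collecting the terms on which [sig] takes
    its least value [e]. *)
Lemma supp_initial (sig : {additive L -> int}) z l : mspan setT z ->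
  in_supp z l -> exists z0 z1 e, [/\ e <= sig l, z = z0 + z1, z0 != 0,
    mspan [set m | sig m = e] z0 & mspan [set m | e < sig m] z1].
Proof.
move=> Tz zl; have [s sz zE] := mspan_supp Tz.
have [ls s0] : l \in [seq p.2 | p <- s] /\ s != [::].
  suff ls : l \in [seq p.2 | p <- s] by split=> //; apply: contraTneq ls => ->.
  apply: contraT => ls; move: zl; rewrite zE => /in_suppE/eqP[].
  rewrite /lcoef big_seq_cond big1 // => p /andP[ps /eqP pl].
  by case/negP: ls; rewrite -pl map_f.
have [q qs qmin] := seq_min (fun p => sig p.2) s0.
pose s1 := [seq p <- s | sig p.2 == sig q.2].
pose s2 := [seq p <- s | sig p.2 != sig q.2].
have zE' : z = mcomb s1 + mcomb s2.
  by rewrite zE /mcomb !big_filter (bigID (fun p => sig p.2 == sig q.2)).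
have s2z1 : mspan [set m | sig q.2 < sig m] (mcomb s2).
  exists s2 => // p; rewrite mem_filter => /andP[pq ps] /=.
  by rewrite lt_neqAle eq_sym pq qmin.
exists (mcomb s1), (mcomb s2), (sig q.2); split=> //.
- by have /mapP[p ps ->] := ls; exact: qmin.
- have : in_supp z q.2 := sz q qs.
  apply: contraPneq => s10; rewrite zE' s10 add0r.
  move/(mspanP _ (mspanT s2z1)): s2z1 => s2z1 /s2z1 /=.
  by rewrite ltxx.
- by exists s1 => // p; rewrite mem_filter => /andP[/eqP].
Qed.

(** The product of the initial parts of [z] and [w] is nonzero, [K] being a
    field, and it is the initial part of [z * w]; so the least values of [sig]
    on [z] and [w] add up to its least value on [z * w]. *)
Lemma supp_nonneg (sig : {additive L -> int}) z w l m :
  mspan setT z -> mspan setT w -> mspan [set l | 0 <= sig l] (z * w) ->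
  in_supp z l -> in_supp w m -> 0 <= sig l + sig m.
Proof.
move=> Tz Tw zw zl wm.
have [z0 [z1 [e [el zE z00 z0P z1P]]]] := supp_initial sig Tz zl.
have [w0 [w1 [f [fm wE w00 w0P w1P]]]] := supp_initial sig Tw wm.
suff ef : 0 <= e + f by exact: le_trans (lerD el fm).
rewrite leNgt; apply/negP => ef.
have z0w0 : mspan [set l | sig l = e + f] (z0 * w0).
  apply: mspanS (mspanM z0P w0P) => _ [x [y [/= xe yf ->]]].
  by rewrite raddfD xe yf.
have : mspan [set l | e + f < sig l] (z0 * w0).
  have -> : z0 * w0 = z * w + - (z0 * w1 + z1 * w0 + z1 * w1).
    by rewrite zE wE; ring.
  apply: mspanD; first by apply: mspanS zw => x /=; exact: lt_le_trans.
  apply/mspanN/mspanD; first apply: mspanD.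
  - apply: mspanS (mspanM z0P w1P) => _ [x [y [/= xe yf ->]]].
    by rewrite raddfD xe ltrD2l.
  - apply: mspanS (mspanM z1P w0P) => _ [x [y [/= xe yf ->]]].
    by rewrite raddfD yf ltrD2r.
  - apply: mspanS (mspanM z1P w1P) => _ [x [y [/= xe yf ->]]].
    by rewrite raddfD ltrD.
have Tz0w0 := mspanT z0w0.
have [x zwx] : in_supp (z0 * w0) !=set0 by apply: supp_neq0; rewrite ?mulf_neq0.
move/(mspanP _ Tz0w0) => /(_ x zwx) /=.
by move/(mspanP _ Tz0w0): z0w0 => /(_ x zwx) /= ->; rewrite ltxx.
Qed.

End Span.

(** * From divisorial ideals of the monoid to those of its algebra *)

Section MonoidColon.
Variables (L : zmodType) (Q : addrClosed L).
Implicit Types M : set L.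

Lemma mcolon_neq0 (D : mdiv Q) : mcolon Q D !=set0.
Proof. by have [[_ _ _ [d Qd dD]] _] := mdivP D; exists d; split; [exact: gpQ|]. Qed.

Lemma mdivisorial_colon M : M !=set0 -> M `<=` gp Q -> mcolon Q M !=set0 ->
  mdivisorial Q (mcolon Q M).
Proof.
move=> [m Mm] Mgp cM0; rewrite -mcolon3 //.
apply: mdivisorial_colon2 => //; first exact: mcolon_gp.
have [x [y [Qx Qy mE]]] := Mgp m Mm.
exists x => // z [_ /(_ m Mm)]; rewrite mE addrCA => xzy.
have -> : x + z = x + (z - y) + y by rewrite -addrA subrK.
exact: rpredD.
Qed.

End MonoidColon.

Section SpanClass.
Variables (k K : fieldType) (L : zmodType).
Variables (kap : {rmorphism k -> K}) (X : L -> K).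
Hypothesis X0 : X 0 = 1.
Hypothesis XD : forall l m, X (l + m) = X l * X m.
Hypothesis X_free :
  forall s, mcomb kap X s = 0 -> forall l, lcoef s l = 0.
Variables (Q : addrClosed L) (A : subringClosed K).
Hypothesis AE : forall z, z \in A <-> mspan kap X [set x | x \in Q] z.
Implicit Types (M N : set L) (z w : K).

Local Notation mspan := (mspan kap X).
Local Notation in_supp := (in_supp kap X).
Let X_neq0 := X_neq0 X0 XD.
Let mspanP := mspanP X_free.

Lemma X_in_A q : q \in Q -> X q \in A.
Proof. by move=> Qq; apply/AE; exact: mspan_X. Qed.

Lemma kap_in_A c : kap c \in A.
Proof.
by apply/AE; rewrite -[kap c]mulr1 -X0; apply: mspan_term; exact: rpred0.
Qed.

Lemma Frac0 : Frac A 0.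
Proof. by apply: Frac_A; exact: rpred0. Qed.

Lemma FracX m : gp Q m -> Frac A (X m).
Proof.
move=> [x [y [Qx Qy ->]]]; exists (X x), (X y); rewrite !X_in_A //.
by split=> //; apply: (mulIf (X_neq0 y)); rewrite divfK // -XD subrK.
Qed.

Lemma FracS M : M `<=` gp Q -> mspan M `<=` Frac A.
Proof.
move=> Mgp; apply: mspan_ind => [||c m /Mgp gm]; first exact: Frac0.
  by move=> z w; exact: FracD.
by apply: FracM; [apply: Frac_A; exact: kap_in_A|exact: FracX].
Qed.

Lemma mspan_sub_A M z : M `<=` [set x | x \in Q] -> mspan M z -> z \in A.
Proof. by move=> MQ zM; apply/AE; exact: mspanS zM. Qed.

(** Multiplying [z] by a single monomial of [M] already forces [z] to be a
    Laurent polynomial; the monomials of [z] can then be tested one by one. *)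
Lemma colon_span M : M !=set0 -> M `<=` gp Q ->
  colon A (mspan M) = mspan (mcolon Q M).
Proof.
move=> [m0 Mm0] Mgp; apply/seteqP; split=> z.
  move=> [_ zM].
  have Tz : mspan setT z.
    apply: (mspanTX X0 XD (m := m0)); rewrite mulrC.
    by apply: mspanT; apply/AE; apply: zM; exact: mspan_X.
  apply/mspanP => // l zl.
  have key m : M m -> l + m \in Q.
    move=> Mm; have : z * X m \in A by apply: zM; exact: mspan_X.
    move/AE => zXm; move: (zXm) => /mspanP -/(_ (mspanT zXm)).
    by rewrite mulrC; apply; rewrite addrC; exact: supp_mulX.
  split=> //; rewrite -(addrK m0 l); apply: gpD; first exact/gpQ/key.
  exact/gpN/Mgp.
move=> zc; split; first by apply: FracS zc; exact: mcolon_gp.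
move=> x xM; apply: mspan_sub_A (mspanM XD zc xM).
by move=> _ [l [m [[_ lM] Mm ->]]]; exact: lM.
Qed.

Lemma ideal_mul_span M N : ideal_mul (mspan M) (mspan N) = mspan (msum M N).
Proof.
apply/seteqP; split; [apply: ideal_mul_ind|apply: mspan_ind].
- exact: mspan0.
- by move=> x y; exact: mspanD.
- by move=> x y; exact: mspanM.
- exact: ideal_mul0.
- by move=> x y; exact: ideal_mulD.
- move=> c _ [m [n [Mm Nn ->]]]; rewrite XD mulrA.
  by apply: ideal_mulM; [exact: mspan_term|exact: mspan_X].
Qed.

Lemma scale_span m M : scale (X m) (mspan M) = mspan (mtranslate m M).
Proof.
apply/seteqP; split=> [_ [z + <-]|].
  move: z; apply: mspan_ind => [|z w|c l Ml].
  - by rewrite mulr0; exact: mspan0.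
  - by rewrite mulrDr; exact: mspanD.
  - by rewrite mulrCA -XD; apply: mspan_term; exists l.
apply: mspan_ind => [|_ _ [z zM <-] [w wM <-]|c _ [l Ml <-]].
- by exists 0; [exact: mspan0|rewrite mulr0].
- by exists (z + w); [exact: mspanD|rewrite mulrDr].
- by exists (kap c * X l); [exact: mspan_term|rewrite XD mulrCA].
Qed.

Lemma span_divisorial (D : mdiv Q) : divisorial A (mspan D).
Proof.
have [[Dg [x Dx] QD [d Qd dD]] DK] := mdivP D.
split; last by rewrite !colon_span ?DK //; [exact: mcolon_neq0|exact: mcolon_gp|exists x].
split.
- split; first exact: FracS.
  by exists (X x); [exact: mspan_X|exact: X_neq0].
- by move=> z w; exact: mspanD.
- move=> c z /AE cQ zD; apply: mspanS (mspanM XD cQ zD).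
  by move=> _ [q [y [Qq Dy ->]]]; exact: QD.
- exists (X d); first by rewrite X_in_A.
  move=> z zD; apply: mspan_sub_A (mspanM XD (mspan_X _ _ (erefl d : [set d] d)) zD).
  by move=> _ [_ [y [-> Dy ->]]]; exact: dD.
Qed.

Definition span_div (D : mdiv Q) : rdiv A := RDiv (span_divisorial D).

Definition span_class (x : mClass Q) : rClass A := rclass (span_div (repr x)).

Lemma span_class_natural D : span_class (mclass D) = rclass (span_div D).
Proof.
have /mclassP [m gm DE] := mclass_repr (mclass D).
apply/rclassP; exists (X m); first by rewrite X_neq0; split=> //; exact: FracX.
by rewrite scale_span -DE.
Qed.

Lemma span_class_additive : nmod_morphism span_class.
Proof.
split=> [|x y].
  rewrite [0 in LHS](_ : _ = mclass (mdiv_one Q)) // span_class_natural.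
  rewrite [RHS](_ : _ = rclass (rdiv_one A)) //; congr rclass; apply: rdiv_inj => /=.
  by apply/seteqP; split=> z /AE.
rewrite -(mclass_repr x) -(mclass_repr y).
rewrite [_ + _ in LHS]mclassM !span_class_natural [RHS]rclassM; congr rclass.
apply: rdiv_inj => /=; rewrite ideal_mul_span.
have gD : msum (repr x) (repr y) `<=` gp Q by apply: msum_gp; exact: mdiv_gp.
have [z Dz] : msum (repr x) (repr y) !=set0.
  have [[_ [u Du] _ _] _] := mdivP (repr x).
  have [[_ [v Dv] _ _] _] := mdivP (repr y).
  by exists (u + v), u, v.
rewrite !colon_span //.
- have [[_ _ _ [d Qd dD]] _] := mdivP (repr x).
  have [[_ _ _ [e Qe eD]] _] := mdivP (repr y).
  exists (d + e); split; first by apply: gpQ; exact: rpredD.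
  by move=> _ [u [v [/dD du /eD ev ->]]]; rewrite addrACA rpredD.
- exact: mcolon_gp.
- by exists z.
Qed.

(** If [mspan D = c (mspan E)] then [c] and its inverse are Laurent
    polynomials. A monomial of [c] times a monomial of [mspan E] has its
    exponent in [D], and symmetrically; so a monomial [m] of [c] whose inverse
    occurs in [c^-1] translates [E] onto [D]. *)
Lemma span_class_inj : injective span_class.
Proof.
move=> x y; rewrite -(mclass_repr x) -(mclass_repr y) !span_class_natural.
move: (repr x) (repr y) => D E /rclassP[c [_ c0] /= DE].
have translate (c' : K) (D' E' : mdiv Q) : mspan D' = scale c' (mspan E') ->
    mspan setT c' /\ forall m e, in_supp c' m -> mdiv_set E' e -> mdiv_set D' (m + e).
  move=> DE'.
  have inD e : mdiv_set E' e -> mspan D' (c' * X e).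
    by move=> Ee; rewrite DE'; exists (X e) => //; exact: mspan_X.
  have Tc : mspan setT c'.
    have [[_ [e Ee] _ _] _] := mdivP E'.
    by apply: (mspanTX X0 XD (m := e)); rewrite mulrC; exact: mspanT (inD e Ee).
  split=> // m e cm /inD ceD; move/mspanP: (ceD) => /(_ (mspanT ceD)).
  by apply; rewrite mulrC addrC; exact: supp_mulX.
have [Tc cDE] := translate _ _ _ DE.
have ED : mspan E = scale c^-1 (mspan D).
  rewrite DE; apply/seteqP; split=> [z zE|_ [_ [z zE <-] <-]].
    by exists (c * z); [exists z|rewrite mulKf].
  by rewrite mulKf.
have [Tc' cED] := translate _ _ _ ED.
have [m cm c'm] := supp_inverse X0 XD X_free Tc Tc' (mulfV c0).
have [[Eg [e Ee] _ _] _] := mdivP E.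
apply/mclassP; exists m.
  rewrite -(addrK e m); apply: gpD; last exact/gpN/Eg.
  by apply: mdiv_gp; exact: cDE Ee.
apply/seteqP; split=> [d Dd|_ [d Ed <-]]; last exact: cDE.
by exists (- m + d); [exact: cED|rewrite addNKr].
Qed.

Hypothesis gpT : forall x, gp Q x.
Variables (J : Type) (sig : J -> {additive L -> int}).
Hypothesis QE : forall x, x \in Q <-> forall j, 0 <= sig j x.
Hypothesis gcdP : forall I : set K, I `<=` [set x | x \in A] ->
  (exists2 x, I x & x != 0) ->
  exists g, [/\ g != 0, forall x, I x -> mspan setT (x / g)
    & forall z, (forall x, I x -> z * (x / g) \in A) -> mspan setT z].

(** With [H] the ideal scaled to have trivial greatest common divisor, [M] is
    the set of monomials multiplying [H] into [A]. *)
Lemma span_class_surj (y : rClass A) : exists x, span_class x = y.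
Proof.
rewrite -(rclass_repr y); move: (repr y) => E {y}.
have [[[Eg [x0 Ex0 x00]] _ _ [d [Ad d0] dE]] EK] := rdivP E.
have [||g [g0 gT gA]] := gcdP (I := scale d E).
- by move=> _ [x Ex <-]; exact: dE.
- by exists (d * x0); [exists x0|rewrite mulf_neq0].
pose c := d / g; have c0 : c != 0 by rewrite mulf_neq0 ?invr_eq0.
have fracT z : mspan setT z -> Frac A z by apply: FracS => x _; exact: gpT.
have cF : Frac A c.
  rewrite -(mulfK x00 c); apply: FracM; last exact/FracV/Eg.
  by apply: fracT; rewrite /c mulrAC; apply: gT; exists x0.
pose H := scale c E.
have ITT f : H f -> mspan setT f.
  by move=> [x Ex <-]; rewrite /c mulrAC; apply: gT; exists x.
have IK : colon A (colon A H) = H.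
  by rewrite /H !colon_scale ?EK ?invrK ?invr_eq0 //; exact: FracV.
have cIT z : colon A H z -> mspan setT z.
  move=> [_ zI]; apply: gA => _ [x Ex <-]; apply: zI; exists x => //.
  by rewrite /c mulrAC.
pose M := [set m | colon A H (X m)].
(* Each product of a monomial of [z] with one of [f] has exponent in [Q],
   form by form. *)
have cIM : colon A H = mspan M.
  apply/seteqP; split=> [z zI|].
    have Tz := cIT z zI; apply/mspanP => // m zm; split; first exact: FracX.
    move=> f If; have Tf := ITT f If.
    have TXf : mspan setT (X m * f) by apply: (mspanTM XD) => //; exact: mspan_X.
    apply/AE/mspanP => // l /(suppM XD X_free (mspan_X _ _ (I : setT m)) Tf).
    move=> [_ [l' [/(in_supp_X X_free) -> fl' ->]]]; apply/QE => j.
    rewrite raddfD; apply: (supp_nonneg XD X_free Tz Tf _ zm fl').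
    have /AE := zI.2 f If; apply: mspanS => x /= /QE; exact.
  apply: mspan_ind => [|z w [zF zI] [wF wI]|a m [mF mI]].
  - by split=> [|x _]; [exact: Frac0|rewrite mul0r rpred0].
  - by split=> [|x Ix]; [exact: FracD|rewrite mulrDl rpredD ?zI ?wI].
  - split=> [|x Ix]; first by apply: FracM => //; apply: Frac_A; exact: kap_in_A.
    by rewrite -mulrA rpredM ?kap_in_A ?mI.
(* [d] multiplies the original ideal into [A], so [d / c] multiplies [H]. *)
have M0 : M !=set0.
  have : colon A H (d / c).
    split; first by apply: FracM; [exact: Frac_A|exact: FracV].
    by move=> _ [x Ex <-]; rewrite mulrA divfK //; exact: dE.
  rewrite cIM => dc; have [|m dcm] := supp_neq0 X_free (mspanT dc).
    by rewrite mulf_neq0 ?invr_eq0.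
  by exists m; move/mspanP: (dc) => /(_ (mspanT dc)); exact.
have IE : H = mspan (mcolon Q M) by rewrite -IK cIM colon_span.
have Mdiv : mdivisorial Q (mcolon Q M).
  apply: mdivisorial_colon => //.
  have Ix : H (c * x0) by exists x0.
  have [|m xm] := supp_neq0 X_free (ITT _ Ix); first by rewrite mulf_neq0.
  exists m; move: (Ix); rewrite IE => /mspanP; apply=> //; exact: ITT.
exists (mclass (MDiv Mdiv)); rewrite span_class_natural; apply/rclassP.
by exists c.
Qed.

End SpanClass.

(** * Divisorial ideals of a monoid cut out by integral forms *)

Lemma int_min (S : set int) (v0 e : int) : S v0 -> (forall v, S v -> e <= v) ->
  exists2 v, S v & forall w, S w -> v <= w.
Proof.
move=> Sv0 Se.
have ex : exists m : nat, `[< S (e + m%:Z) >].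
  exists (absz (v0 - e)); apply/asboolP; rewrite gez0_abs ?subr_ge0 ?Se //.
  by rewrite subrKC.
case: (ex_minnP ex) => m /asboolP Sm mmin; exists (e + m%:Z) => // w Sw.
have /mmin : `[< S (e + (absz (w - e))%:Z) >].
  apply/asboolP; rewrite gez0_abs ?subr_ge0 ?Se //.
  by rewrite subrKC.
by have := Se w Sw; lia.
Qed.

Section Facets.
Variables (L : zmodType) (Q : addrClosed L) (J : Type).
Variable sig : J -> {additive L -> int}.
Hypothesis QE : forall x, x \in Q <-> forall j, 0 <= sig j x.
Hypothesis facet_attained : forall (p : J -> int) j,
  exists2 x, sig j x = p j & forall i, p i <= sig i x.
Variable j0 : J.
Implicit Types (D E : mdiv Q) (j : J) (p : J -> int).

Lemma facet_above p : exists x, forall j, p j <= sig j x.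
Proof. by have [x _ px] := facet_attained p j0; exists x. Qed.

Lemma gp_total x : gp Q x.
Proof.
have [y yP] := facet_above (fun j => Num.max 0 (- sig j x)).
exists (y + x), y; split; last by rewrite addrAC subrr add0r.
  apply/QE => j; rewrite raddfD; have := yP j.
  by rewrite ge_max => /andP[_]; lia.
by apply/QE => j; have := yP j; rewrite ge_max => /andP[].
Qed.

Definition is_ord D j (v : int) : Prop :=
  (exists2 x, mdiv_set D x & sig j x = v) /\
  forall x, mdiv_set D x -> v <= sig j x.

Definition ord D j : int := xget 0 [set v | is_ord D j v].

Lemma ordP D j : is_ord D j (ord D j).
Proof.
suff [v vP] : exists v, is_ord D j v by exact: (xgetPex 0 (ex_intro _ v vP)).
have [[_ [x Dx] _ [d _ dD]] _] := mdivP D.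
have [||v [y Dy yE] vmin] := int_min (S := [set sig j y | y in mdiv_set D])
    (v0 := sig j x) (e := - sig j d).
- by exists x.
- by move=> _ [y /dD/QE/(_ j) dy <-]; move: dy; rewrite raddfD; lia.
exists v; split; first by exists y.
by move=> z Dz; apply: vmin; exists z.
Qed.

Lemma ord_eq D j v : is_ord D j v -> ord D j = v.
Proof.
move=> [[x Dx xE] vmin]; have [[y Dy yE] omin] := ordP D j.
by apply/le_anti; rewrite -{1}xE omin // -yE vmin.
Qed.

Lemma mdiv_ordE D x : mdiv_set D x <-> forall j, ord D j <= sig j x.
Proof.
split=> [Dx j|ordx]; first by have [_] := ordP D j; apply.
rewrite -(mdivK D); split=> [|z [_ zD]]; first exact: gp_total.
apply/QE => j; have [[y Dy yE] _] := ordP D j.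
have := zD y Dy => /QE/(_ j); have := ordx j; rewrite !raddfD -yE; lia.
Qed.

Lemma mcolon_halfspaces p : mcolon Q [set x | forall j, p j <= sig j x] =
  [set x | forall j, - p j <= sig j x].
Proof.
apply/seteqP; split=> [z [_ zp] j|z zp].
  have [x xE xp] := facet_attained p j.
  by have /QE/(_ j) := zp x xp; rewrite raddfD xE; lia.
split=> [|x xp]; first exact: gp_total.
by apply/QE => j; rewrite raddfD; have := zp j; have := xp j; lia.
Qed.

(** The half-space intersection with bounds [p] is divisorial because taking
    its colon negates [p]. *)
Lemma ord_surj p : exists D, ord D =1 p.
Proof.
have [D DE] : exists D, mdiv_set D = [set x | forall j, p j <= sig j x].
  suff pP : mdivisorial Q [set x | forall j, p j <= sig j x] by exists (MDiv pP).
  split; last first.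
    by rewrite !mcolon_halfspaces; apply/seteqP; split=> x /= xp j;
      have := xp j; rewrite opprK.
  split; first by move=> x _; exact: gp_total.
  - exact: facet_above.
  - move=> q x /QE Qq px j; rewrite raddfD; have := Qq j; have := px j; lia.
  have [d dp] := facet_above (fun j => Num.max 0 (- p j)).
  exists d; first by apply/QE => j; have := dp j; rewrite ge_max => /andP[].
  move=> x px; apply/QE => j; have := dp j; rewrite ge_max => /andP[_].
  by rewrite raddfD; have := px j; lia.
exists D => j; apply: ord_eq; rewrite /is_ord DE; split=> [|x]; last exact.
by have [x xE xp] := facet_attained p j; exists x.
Qed.

Lemma ord_one j : ord (mdiv_one Q) j = 0.
Proof.
apply: ord_eq; split=> [|x /QE]; last exact.
by have [x xE xp] := facet_attained (fun=> 0) j; exists x => //; apply/QE.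
Qed.

(** The sum of the minima is attained on [D + E]. To bound the double colon
    from below, test it against a point of the colon of [D + E] at which the
    form [j] takes the value [- (ord D j + ord E j)]. *)
Lemma ord_mul D E j : ord (mdiv_mul D E) j = ord D j + ord E j.
Proof.
have gDE : msum D E `<=` gp Q by move=> x _; exact: gp_total.
apply: ord_eq; split.
  have [[[x Dx xE] _] [[y Ey yE] _]] := (ordP D j, ordP E j).
  exists (x + y); last by rewrite raddfD xE yE.
  by apply: sub_mcolon2 => //; exists x, y.
move=> x [_ xDE].
have [z zE zmin] := facet_attained (fun i => - (ord D i + ord E i)) j.
have /xDE/QE/(_ j) : mcolon Q (msum D E) z.
  split=> [|_ [u [v [/mdiv_ordE Du /mdiv_ordE Ev ->]]]]; first exact: gp_total.
  apply/QE => i; rewrite !raddfD; have := zmin i; have := Du i; have := Ev i.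
  lia.
by rewrite raddfD zE; lia.
Qed.

Lemma mclass_ordP D E : mclass D = mclass E <->
  exists m, forall j, ord D j = sig j m + ord E j.
Proof.
split=> [/mclassP[m _ DE]|[m DE]].
  exists m => j; apply: ord_eq; have [[x Ex xE] omin] := ordP E j.
  split; first by exists (m + x); [rewrite DE; exists x|rewrite raddfD xE].
  by rewrite DE => _ [y Ey <-]; rewrite raddfD; have := omin y Ey; lia.
apply/mclassP; exists m; first exact: gp_total.
apply/seteqP; split=> [x /mdiv_ordE xD|_ [x /mdiv_ordE xE <-]].
  exists (- m + x); last by rewrite addNKr.
  apply/mdiv_ordE => j; rewrite raddfD raddfN addrC lerBrDl -DE; exact: xD.
by apply/mdiv_ordE => j; have := xE j; rewrite DE raddfD; lia.
Qed.

End Facets.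

(** * The class group of [Q(a, b)] *)

Section Cone.
Variables (n : nat) (a b : 'I_n -> nat).
Hypotheses (a_gt0 : forall i, (0 < a i)%N) (b_gt0 : forall i, (0 < b i)%N).
Local Notation L := (int * int * 'rV[int]_n)%type.

Variant facet : Type := FacetU | FacetV | FacetA of 'I_n | FacetB of 'I_n.

Definition facet_form (j : facet) (m : L) : int :=
  match j with
  | FacetU => m.1.1
  | FacetV => m.1.2
  | FacetA i => m.2 0 i - (a i)%:Z * m.1.1
  | FacetB i => m.2 0 i - (b i)%:Z * m.1.2
  end.

Lemma facet_form_additive j : zmod_morphism (facet_form j).
Proof. by case: j => [||i|i] [[r s] t] [[r' s'] t'] //=; rewrite !mxE; ring. Qed.

HB.instance Definition _ j :=
  GRing.isZmodMorphism.Build L int (facet_form j) (facet_form_additive j).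

(** The forms as a family of bundled additive maps, so that [ord facet_sig] has
    a single syntactic form. *)
Definition facet_sig (j : facet) : {additive L -> int} := facet_form j.

Lemma Q_facets x : x \in Q a b <-> forall j, 0 <= facet_sig j x.
Proof.
case: x => [[r s] t]; split=> [/and3P[/= r0 s0 /forallP t0] [||i|i] //=|x0].
- by have /andP[_] := t0 i; rewrite ge_max subr_ge0 => /andP[].
- by have /andP[_] := t0 i; rewrite ge_max subr_ge0 => /andP[].
have r0 := x0 FacetU; have s0 := x0 FacetV.
apply/and3P; split=> //; apply/forallP => i.
have ar : (a i)%:Z * r <= t 0 i by rewrite -subr_ge0; exact: (x0 (FacetA i)).
have bs : (b i)%:Z * s <= t 0 i by rewrite -subr_ge0; exact: (x0 (FacetB i)).
by rewrite ge_max ar bs !andbT (le_trans _ ar) // mulr_ge0.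
Qed.

(** Only the coordinates [r] and [s] have to be chosen: each [t_i] is then the
    larger of the lower bounds [a_i r + p_i] and [b_i s + q_i]. To attain the
    bound on [t_i - a_i r], take [r] so large that the first one wins; to attain
    the one on [t_i - b_i s], take [s] large. This is where [a_i] and [b_i] have
    to be positive. *)
Lemma facet_attained (p : facet -> int) j :
  exists2 x, facet_sig j x = p j & forall i, p i <= facet_sig i x.
Proof.
pose x r s : L := (r, s, \row_i Num.max ((a i)%:Z * r + p (FacetA i))
                                     ((b i)%:Z * s + p (FacetB i))).
have xP r s : p FacetU <= r -> p FacetV <= s ->
    forall i, p i <= facet_form i (x r s).
  by move=> pr ps [||i|i] //=; rewrite mxE; lia.
case: j => [||i|i].
- by exists (x (p FacetU) (p FacetV)); [|exact: xP].
- by exists (x (p FacetU) (p FacetV)); [|exact: xP].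
- pose c := (b i)%:Z * p FacetV + p (FacetB i) - p (FacetA i).
  exists (x (`|p FacetU| + `|c|) (p FacetV)); last by apply: xP; lia.
  rewrite /= mxE max_l; first by rewrite addrC addKr.
  suff : c <= (a i)%:Z * (`|p FacetU| + `|c|) by rewrite /c; lia.
  by have := a_gt0 i; nia.
- pose c := (a i)%:Z * p FacetU + p (FacetA i) - p (FacetB i).
  exists (x (p FacetU) (`|p FacetV| + `|c|)); last by apply: xP; lia.
  rewrite /= mxE max_r; first by rewrite addrC addKr.
  suff : c <= (b i)%:Z * (`|p FacetV| + `|c|) by rewrite /c; lia.
  by have := b_gt0 i; nia.
Qed.

Local Notation ord := (ord facet_sig).

(** The combination of the minima that vanishes on the values of the forms at a
    lattice point, that is, on principal ideals. *)
Definition div_coord (D : mdiv (Q a b)) : 'rV[int]_n :=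
  \row_i (ord D (FacetA i) - ord D (FacetB i)
          + (a i)%:Z * ord D FacetU - (b i)%:Z * ord D FacetV).

Definition class_coord (x : mClass (Q a b)) : 'rV[int]_n := div_coord (repr x).

Let mclass_ordP := mclass_ordP Q_facets facet_attained FacetU.

Lemma div_coord_eq D E : div_coord D = div_coord E <-> mclass D = mclass E.
Proof.
split=> [/rowP DE|/mclass_ordP[[[r s] t] DE]]; last first.
  by apply/rowP => i; rewrite !mxE !DE /=; ring.
apply/mclass_ordP.
exists (ord D FacetU - ord E FacetU, ord D FacetV - ord E FacetV,
  \row_i (ord D (FacetA i) - ord E (FacetA i)
          + (a i)%:Z * (ord D FacetU - ord E FacetU))).
case=> [||i|i] /=; rewrite ?mxE /=; [ring|ring|ring|].
have := DE i; rewrite !mxE => e.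
by move: e; lia.
Qed.

Lemma class_coordE D : class_coord (mclass D) = div_coord D.
Proof. by apply/div_coord_eq; exact: mclass_repr. Qed.

Lemma class_coord_additive : nmod_morphism class_coord.
Proof.
split=> [|x y].
  rewrite [0 in LHS](_ : _ = mclass (mdiv_one (Q a b))) // class_coordE.
  apply/rowP => i; rewrite !mxE !(ord_one Q_facets facet_attained).
  by rewrite !mulr0 !subr0.
rewrite -(mclass_repr x) -(mclass_repr y).
rewrite [_ + _ in LHS]mclassM !class_coordE.
apply/rowP => i; rewrite !mxE !(ord_mul Q_facets facet_attained FacetU).
ring.
Qed.

Lemma class_coord_bij : bijective class_coord.
Proof.
have inj : injective class_coord.
  move=> x y; rewrite -(mclass_repr x) -(mclass_repr y) !class_coordE.
  by move/div_coord_eq.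
have surj v : exists x, class_coord x = v.
  have [D DE] := ord_surj Q_facets facet_attained FacetU
    (fun j => if j is FacetA i then v 0 i else 0).
  exists (mclass D); rewrite class_coordE; apply/rowP => i.
  by rewrite mxE !DE; ring.
have [g gP] := choice surj.
exists g => // x; exact/inj/gP.
Qed.

End Cone.

(** * Laurent monomials and the intersection algebra *)

Lemma fraction_div (D : idomainType) (z : {fraction D}) :
  exists n d : D, d != 0 /\ z = tofrac n / tofrac d.
Proof.
elim/quotW: z => x; exists (frac x).1, (frac x).2.
have d0 := denom_ratioP x; split=> //.
apply: (canRL (mulfK _)); first by rewrite tofrac_eq0.
unlock tofrac; rewrite -[LHS](FracField.pi_mul x (Ratio (frac x).2 1)).
apply/eqP; rewrite FracField.equivf_def /FracField.mulf /=.
by rewrite !numden_Ratio ?mulr1 ?oner_eq0 // mulrC.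
Qed.

Lemma tofrac_monomial (R : idomainType) n (x : 'I_n -> R) (e : 'I_n -> nat)
    (r s : nat) :
  tofrac ((\prod_(i < n) x i ^+ e i *: 'X^r) *: 'X^s : {poly {poly R}}) =
  tofrac 'X%:P ^+ r * tofrac 'X ^+ s * \prod_(i < n) tofrac (x i)%:P%:P ^+ e i.
Proof.
rewrite -!mul_polyC polyCM !rmorphM !rmorph_prod /= -mulrA mulrC.
by rewrite !rmorphXn; congr (_ * _); apply: eq_bigr => i _; rewrite !rmorphXn.
Qed.

Lemma mul_cross (F : fieldType) (w d q g : F) : d != 0 ->
  w * (q * g) = w / d * q * (d * g).
Proof. by move=> d0; rewrite -!mulrA mulrCA mulrA; field. Qed.

Section Laurent.
Variables (k : fieldType) (n : nat).
Local Notation R := {mpoly k[n]}.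
Local Notation Ruv := {poly {poly R}}.
Local Notation K := {fraction Ruv}.
Local Notation L := (int * int * 'rV[int]_n)%type.

(** The scalars of [kspan], as a bundled ring morphism. *)
Definition scalar_frac : {rmorphism k -> K} :=
  @tofrac Ruv \o @polyC {poly R} \o @polyC R \o @mpolyC n k.

Lemma kspanE (M : set L) : kspan M = mspan scalar_frac (@laurent k n) M.
Proof. by []. Qed.

Lemma laurent0 : laurent k (0 : L) = 1.
Proof.
by rewrite /laurent !expr0z !mul1r big1 // => i _; rewrite mxE expr0z.
Qed.

Lemma laurentD (l m : L) : laurent k (l + m) = laurent k l * laurent k m.
Proof.
rewrite /laurent /= !expfzDr ?tofrac_eq0 ?polyC_eq0 ?polyX_eq0 //.
rewrite [RHS]mulrACA [X in _ = X * _]mulrACA; congr (_ * _).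
rewrite -big_split; apply: eq_bigr => i _; rewrite mxE expfzDr //.
by rewrite tofrac_eq0 !polyC_eq0 -msupp_eq0 msuppX.
Qed.

Definition nonneg (m : L) : Prop :=
  [/\ 0 <= m.1.1, 0 <= m.1.2 & forall i, 0 <= m.2 0 i].

Lemma nonnegD l m : nonneg l -> nonneg m -> nonneg (l + m).
Proof.
move=> [l1 l2 l3] [m1 m2 m3]; split; rewrite /= ?addr_ge0 // => i.
by rewrite mxE addr_ge0.
Qed.

Lemma nonneg_shift (s : seq L) :
  exists2 e, nonneg e & forall m, m \in s -> nonneg (m + e).
Proof.
elim: s => [|l s [e e0 IH]]; first by exists 0 => //; split=> // i; rewrite mxE.
pose e' : L := (`|l.1.1|, `|l.1.2|, \row_i `|l.2 0 i|).
have e'0 : nonneg e' by split=> //= i; rewrite mxE.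
have le' : nonneg (l + e').
  by split=> [||i] /=; rewrite ?mxE addrC -lerBlDr sub0r -normrN ler_norm.
exists (e' + e); first exact: nonnegD.
move=> m; rewrite inE => /predU1P[->|/IH me].
  by rewrite addrA; exact: nonnegD.
by rewrite addrCA; exact: nonnegD.
Qed.

Definition expo (m : L) : 'X_{1..n} := [multinom absz (m.2 0%R i) | i < n].

Definition pmono (m : L) : Ruv :=
  ('X_[expo m] *: 'X^(absz m.1.1)) *: 'X^(absz m.1.2).

Lemma laurent_pmono m : nonneg m -> laurent k m = tofrac (pmono m).
Proof.
move=> [m1 m2 m3]; rewrite /pmono mpolyXE_id.
apply: etrans (esym (tofrac_monomial _ _ _ _)).
rewrite /laurent -{1}(gez0_abs m1) -{1}(gez0_abs m2); congr (_ * _).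
by apply: eq_bigr => i _; rewrite -{1}(gez0_abs (m3 i)) mnmE.
Qed.

Lemma nonneg_inj l m : nonneg l -> nonneg m ->
  [&& absz l.1.1 == absz m.1.1, absz l.1.2 == absz m.1.2 & expo l == expo m] = (l == m).
Proof.
case: l m => [[lr ls] lt] [[mr ms] mt] [/= l1 l2 l3] [/= m1 m2 m3].
apply/and3P/eqP => [[/eqP e1 /eqP e2 /eqP e3]|[-> -> ->]]; last by rewrite !eqxx.
congr (_, _, _); [lia|lia|apply/rowP => i].
have := congr1 (fun x : 'X_{1..n} => x i) e3; rewrite !mnmE /=.
by have := l3 i; have := m3 i; lia.
Qed.

Lemma coef_pmono l m c : nonneg l -> nonneg m ->
  (c%:MP%:P%:P * pmono m)`_(absz l.1.2)`_(absz l.1.1)@_(expo l) = c * (m == l)%:R.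
Proof.
move=> l0 m0; rewrite coefCM coefZ coefXn coefCM -(nonneg_inj m0 l0).
rewrite [absz m.1.2 == _]eq_sym [absz m.1.1 == _]eq_sym.
case: (absz l.1.2 == _) => /=; last first.
  by rewrite andbF !mulr0n mulr0 coef0 mulr0 mcoeff0 mulr0.
rewrite mulr1n mulr1 coefZ coefXn; case: (absz l.1.1 == _) => /=; last first.
  by rewrite !mulr0n !mulr0 mcoeff0.
by rewrite mulr1n mulr1 mcoeffCM mcoeffX.
Qed.

(** After multiplication by a monomial clearing all denominators, the
    coefficient of a polynomial at the exponent [l] is read off. *)
Lemma laurent_free s : mcomb scalar_frac (@laurent k n) s = 0 ->
  forall l, lcoef s l = 0.
Proof.
move=> s0 l; have [e e0 es] := nonneg_shift (l :: [seq p.2 | p <- s]).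
have le : nonneg (l + e) by apply: es; rewrite inE eqxx.
have : \sum_(p <- s) p.1%:MP%:P%:P * pmono (p.2 + e) = 0.
  apply/eqP; rewrite -(@tofrac_eq0 Ruv) rmorph_sum /=; apply/eqP.
  transitivity (mcomb scalar_frac (@laurent k n) s * laurent k e); last first.
    by rewrite s0 mul0r.
  rewrite /mcomb mulr_suml; apply: eq_big_seq => p ps.
  rewrite rmorphM /= -mulrA -laurentD laurent_pmono //.
  by apply: es; rewrite inE map_f ?orbT.
move/(congr1 (fun f : Ruv => f`_(absz (l + e).1.2)`_(absz (l + e).1.1)@_(expo (l + e)))).
rewrite !coef_sum raddf_sum /= !coef0 mcoeff0 => <-.
rewrite /lcoef big_mkcond; apply: eq_big_seq => p ps.
rewrite coef_pmono //; last by apply: es; rewrite inE map_f ?orbT.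
by rewrite (inj_eq (addIr e)); case: eqP; rewrite ?mulr1 ?mulr0.
Qed.

Definition expl (r s : nat) (t : 'X_{1..n}) : L := (r%:Z, s%:Z, \row_i (t i)%:Z).

Lemma expl_nonneg r s t : nonneg (expl r s t).
Proof. by split=> // i; rewrite mxE. Qed.

Lemma expo_expl r s t : expo (expl r s t) = t.
Proof. by apply/mnmP => i; rewrite mnmE mxE. Qed.

Lemma laurent_tofrac c m : nonneg m ->
  scalar_frac c * laurent k m = tofrac (c%:MP%:P%:P * pmono m : Ruv).
Proof. by move=> m0; rewrite laurent_pmono // rmorphM. Qed.

Lemma pmono_expl r s t :
  pmono (expl r s t) = ('X_[t] *: 'X^r) *: 'X^s.
Proof. by rewrite /pmono expo_expl. Qed.

Lemma sum_pmono (f : Ruv) :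
  f = \sum_(j < size f) \sum_(i < size f`_j) \sum_(t <- msupp f`_j`_i)
        (f`_j`_i@_t)%:MP%:P%:P * pmono (expl i j t).
Proof.
rewrite -{1}[f]coefK poly_def; apply: eq_bigr => j _.
rewrite -{1}[f`_j]coefK poly_def scaler_suml; apply: eq_bigr => i _.
rewrite {1}[f`_j`_i]mpolyE !scaler_suml; apply: eq_bigr => t _.
by rewrite pmono_expl mul_polyC scalerA mul_polyC scalerA mul_mpolyC.
Qed.

Lemma tofrac_kspan (f : Ruv) (M : set L) :
  (forall (r s : nat) t, f`_s`_r@_t != 0 -> M (expl r s t)) ->
  kspan M (tofrac f).
Proof.
move=> fM; rewrite kspanE; pose P (g : Ruv) := mspan scalar_frac (@laurent k n) M (tofrac g).
have P0 : P 0 by rewrite /P tofrac0; exact: mspan0.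
have PD x y : P x -> P y -> P (x + y) by rewrite /P tofracD; exact: mspanD.
rewrite (sum_pmono f) -/(P _).
apply: (big_ind P) => // j _; apply: (big_ind P) => // i _.
rewrite big_seq; apply: (big_ind P) => // t; rewrite mcoeff_msupp => /fM Mt.
rewrite /P -laurent_tofrac; first exact: mspan_term.
exact: expl_nonneg.
Qed.

Lemma ideal_exp_principal (g f : R) r :
  ideal_exp (principal_ideal g) r f <-> exists h, f = h * g ^+ r.
Proof.
split=> [|[h ->]].
  elim: r f => [|r IH] f /=; first by exists f; rewrite mulr1.
  move: f; apply: ideal_mul_ind => [|x y [u ->] [v ->]|x y [u ->] /IH[v ->]].
  - by exists 0; rewrite mul0r.
  - by exists (u + v); rewrite mulrDl.
  - by exists (u * v); rewrite mulrACA exprS.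
elim: r h => [|r IH] h //=; rewrite exprS mulrA; apply: ideal_mulM.
  by exists h.
by rewrite -[g ^+ r]mul1r; exact: IH.
Qed.

Lemma dvd_mpolyX (m : 'X_{1..n}) (f : R) :
  (exists h, f = h * 'X_[m]) <-> (forall t, f@_t != 0 -> (m <= t)%MM).
Proof.
split=> [[h ->] t|fm].
  rewrite -mcoeff_msupp (perm_mem (msuppMX h m)) => /mapP[t' _ ->].
  exact: lem_addr.
exists (\sum_(t <- msupp f) f@_t *: 'X_[(t - m)%MM]).
rewrite mulr_suml {1}[f]mpolyE; apply: eq_big_seq => t.
rewrite mcoeff_msupp => /fm mt.
by rewrite -scalerAl -mpolyXD submK.
Qed.

Lemma monomial_idealP (c : 'I_n -> nat) r (f : R) :
  ideal_exp (monomial_ideal c) r f <->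
  (forall t, f@_t != 0 -> forall i, (c i * r <= t i)%N).
Proof.
rewrite /monomial_ideal ideal_exp_principal.
have -> : \prod_(i < n) 'X_i ^+ c i = 'X_[[multinom c i | i < n]] :> R.
  by rewrite mpolyXE_id; apply: eq_bigr => i _; rewrite mnmE.
rewrite mpolyXn dvd_mpolyX; split=> H t /H => [/mnm_lepP mt i|mt].
  by have := mt i; rewrite mulmnE mnmE.
by apply/mnm_lepP => i; rewrite mulmnE mnmE.
Qed.

Variables a b : 'I_n -> nat.

Lemma Q_nonneg m : m \in Q a b -> nonneg m.
Proof.
move=> /and3P[m1 m2 /forallP m3]; split=> // i.
by have /andP[] := m3 i.
Qed.

Lemma expl_Q r s t : expl r s t \in Q a b <->
  (forall i, (a i * r <= t i)%N /\ (b i * s <= t i)%N).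
Proof.
split=> [/and3P[_ _ /forallP H] i|H].
  have /andP[_] := H i; rewrite /= mxE ge_max -!PoszM !lez_nat.
  by move=> /andP[].
apply/and3P; split=> //; apply/forallP => i; have [ar bs] := H i.
by rewrite /= mxE ge_max -!PoszM !lez_nat ar bs.
Qed.

Lemma intersection_algebraP (f : Ruv) : intersection_algebra a b f <->
  (forall (r s : nat) t, f`_s`_r@_t != 0 -> expl r s t \in Q a b).
Proof.
split=> [Hf r s t ft|Hf r s].
  have [/monomial_idealP/(_ t ft) ar /monomial_idealP/(_ t ft) bs] := Hf r s.
  by apply/expl_Q.
by split; apply/monomial_idealP => t /Hf/expl_Q H i; have [] := H i.
Qed.

Lemma B_kspan z : z \in B k a b <-> kspan [set x | x \in Q a b] z.
Proof.
split=> [/asboolP[f /intersection_algebraP fQ ->]|]; first exact: tofrac_kspan.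
rewrite kspanE; elim/mspan_ind => [|x y|c m /= Qm].
- exact: rpred0.
- exact: rpredD.
have m0 := Q_nonneg Qm.
rewrite laurent_tofrac //; apply/asboolP; exists (c%:MP%:P%:P * pmono m) => //.
apply/intersection_algebraP => r s t.
rewrite -{1 2}[r]/(absz (expl r s t).1.1) -{1}[s]/(absz (expl r s t).1.2).
rewrite -[X in _@_X](expo_expl r s).
rewrite coef_pmono //; last exact: expl_nonneg.
by case: (m =P _) => [<- //|_]; rewrite mulr0 eqxx.
Qed.

(** [B] consists of polynomials, so the greatest common divisor [g] may be
    taken in the factorial ring [Ruv]; a fraction [w / d] multiplying [I / g]
    into [B] then has [d] dividing [w]. *)
Lemma B_gcd (I : set K) : I `<=` [set x | x \in B k a b] ->
  (exists2 x, I x & x != 0) ->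
  exists g, [/\ g != 0, forall x, I x -> kspan setT (x / g)
    & forall z, (forall x, I x -> z * (x / g) \in B k a b) -> kspan setT z].
Proof.
move=> IB [x Ix x0]; have Btofrac z : z \in B k a b -> exists f, z = tofrac f.
  by move=> /asboolP[f _ ->]; exists f.
have [f xE] := Btofrac x (IB x Ix).
have factR : factorial_dom Ruv.
  by apply: factorial_poly; apply: factorial_poly; exact: factorial_mpoly.
have [||g [gI gP]] := gcd_exists factR (J := fun f => I (tofrac f)) (x := f).
- by rewrite -xE.
- by rewrite -(@tofrac_eq0 Ruv) -xE.
have g0 : g != 0.
  have [|q fE] := gI f; first by rewrite -xE.
  by apply: contra_neq x0 => g0; rewrite xE fE g0 mulr0 rmorph0.
have tg0 : tofrac g != 0 by rewrite tofrac_eq0.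
have quot y : I y -> exists q, y = tofrac (q * g : Ruv) /\ y / tofrac g = tofrac q.
  move=> Iy; have [h yE] := Btofrac y (IB y Iy).
  have [|q hE] := gI h; first by rewrite -yE.
  by exists q; rewrite -hE; split=> //; rewrite yE hE rmorphM mulfK.
exists (tofrac g); split=> // [y Iy|z zI].
  have [q [_ ->]] := quot y Iy; exact: tofrac_kspan.
have [w [d [d0 zE]]] := fraction_div z.
have td0 : tofrac d != 0 by rewrite tofrac_eq0.
have [|y Iy|q] := gP (d * g) w; first by rewrite mulf_neq0.
  have [q [yE yq]] := quot _ Iy.
  have [h] := Btofrac _ (zI _ Iy); rewrite yq zE => hE; exists h.
  apply/eqP; rewrite -(@tofrac_eq Ruv) !tofracM yE -hE tofracM.
  by apply/eqP/mul_cross.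
move=> qE; rewrite zE; suff -> : w = q * d.
  by rewrite rmorphM mulfK //; exact: tofrac_kspan.
by apply: (mulIf g0); rewrite qE mulrA.
Qed.

End Laurent.

Theorem proposition1p11 (k : fieldType) (n : nat) (a b : 'I_n -> nat)
    (n_gt0 : (0 < n)%N)
    (a_gt0 : forall i, (0 < a i)%N) (b_gt0 : forall i, (0 < b i)%N)
    (ab_fan : fan_ordered a b) :
  (exists Phi : {additive ClQ a b -> ClB k a b},
     natural_map Phi /\ bijective Phi) /\
  (exists psi : {additive ClQ a b -> 'rV[int]_n}, bijective psi).
Proof.
have gpT := gp_total (@Q_facets n a b) (facet_attained a_gt0 b_gt0) (FacetU n).
split.
  pose X0 := @laurent0 k n; pose XD := @laurentD k n.
  pose Phi := span_class X0 XD (@laurent_free k n) (@B_kspan k n a b).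
  pose PhiA := GRing.isNmodMorphism.Build (ClQ a b) (ClB k a b) Phi
    (span_class_additive X0 XD (@laurent_free k n) (@B_kspan k n a b)).
  pose PhiM : {additive ClQ a b -> ClB k a b} := HB.pack Phi PhiA.
  exists PhiM; split=> [D|].
    by exists (span_div X0 XD (@laurent_free k n) (@B_kspan k n a b) D);
      [|exact: span_class_natural].
  have [g gK] := choice (span_class_surj X0 XD (@laurent_free k n)
    (@B_kspan k n a b) gpT (@Q_facets n a b) (@B_gcd k n a b)).
  exists g => // x; apply: (span_class_inj (gK _)).
pose psiA := GRing.isNmodMorphism.Build (ClQ a b) 'rV[int]_n
  (@class_coord n a b) (class_coord_additive a_gt0 b_gt0).
pose psiM : {additive ClQ a b -> 'rV[int]_n} := HB.pack (@class_coord n a b) psiA.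
by exists psiM; exact: class_coord_bij.
Qed.
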